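(* For every $n\in\mathbb{N}=\{0,1,2,\dots\}$ and every $a\in\mathbb{D}$ one has $\mathrm{M_F}(k_{n,a})=\mathrm{M_F}(e_{n,a})=n$. Moreover, for every $n\ge 1$ and every $n$-tuple $(a_1,\dots,a_n)$ of points of $\mathbb{D}$ (repetitions allowed), the $n$-th Takenaka–Malmquist function $$B_n(z)=\frac{\sqrt{1-|a_n|^2}}{1-\overline{a_n}z}\prod_{l=1}^{n-1}\frac{z-a_l}{1-\overline{a_l}z}$$ satisfies $\mathrm{M_F}(B_n)=n-1$.
   Context: $\mathbb{D}$ is the open unit disc and $H^2(\mathbb{D})$ the Hardy space of the disc. For $a\in\mathbb{D}$, $k_a(z)=\frac{1}{1-\overline{a}z}$ is the Szegő kernel; the multiple Szegő kernels are $k_{n,a}(z)=\left(\frac{\partial}{\partial\overline{a}}\right)^n k_a(z)=\frac{n!\,z^n}{(1-\overline{a}z)^{n+1}}$, and $e_{n,a}=k_{n,a}/\|k_{n,a}\|_{H^2}$. Mean-frequency: every $f\in H^2(\mathbb{D})$, $f\not\equiv 0$, factors (uniquely up to unimodular constants) as $f=\phi\, s\, o$ with $\phi$ a Blaschke product, $s$ a singular inner function and $o$ an outer function; on the boundary, a.e., $\phi(e^{it})=e^{i\theta_\phi(t)}$ and $s(e^{it})=e^{i\theta_s(t)}$ with real phase functions $\theta_\phi,\theta_s$. The mean-frequency of $f$ is $\mathrm{M_F}(f)=\frac{1}{2\pi}\left(\int_0^{2\pi}\theta_\phi'(t)\,dt+\int_0^{2\pi}\theta_s'(t)\,dt\right)$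 (so that, e.g., $\mathrm{M_F}(z^n)=n$ and the mean-frequency of a Möbius factor $\frac{z-a}{1-\overline{a}z}$ equals $1$, and outer functions have mean-frequency $0$). *)

(* Defs.v *)
From HB Require Import structures.
From mathcomp Require Import all_boot all_order all_algebra.
From mathcomp Require Import complex.
From mathcomp Require Import all_classical all_reals all_analysis.

Set Implicit Arguments.
Unset Strict Implicit.
Unset Printing Implicit Defensive.

Import Order.TTheory GRing.Theory Num.Theory.
Import numFieldNormedType.Exports.

Local Open Scope classical_set_scope.
Local Open Scope ring_scope.
Local Open Scope complex_scope.

Notation normc := (@ComplexField.Normc.normc _).

Section HardyDefs.
Variable R : realType.

Definition cexp (z : R[i]) : R[i] :=
  (expR (complex.Re z))%:C * (cos (complex.Im z) +i* sin (complex.Im z)).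
Definition expi (t : R) : R[i] := cos t +i* sin t.

Definition in_disc (z : R[i]) : Prop := normc z < 1.

Definition ccvg (u : nat -> R[i]) (w : R[i]) : Prop :=
  (fun k => normc (u k - w)) @ \oo --> (0 : R).

Definition in_H2 (f : R[i] -> R[i]) : Prop :=
  exists c : nat -> R[i],
    cvg (series (fun k => normc (c k) ^+ 2) @ \oo) /\
    forall z, in_disc z -> ccvg (fun N => \sum_(k < N) c k * z ^+ k) (f z).

Definition H2_norm (f : R[i] -> R[i]) : R :=
  Num.sqrt (sup [set ((2 * pi)%R)^-1 *
     fine (\int[lebesgue_measure]_(t in `[0%R, (2 * pi)%R]%classic)
             (normc (f (r%:C * expi t)) ^+ 2)%:E)
     | r in `[0%R, 1[%classic]).

Definition herglotz_kernel (t : R) (z : R[i]) : R[i] :=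
  (expi t + z) / (expi t - z).

Definition herglotz (mu : {measure set (measurableTypeR R) -> \bar R}) (k : R -> R) (z : R[i])
  : R[i] :=
  fine (\int[mu]_(t in `[0%R, (2 * pi)%R[%classic) (complex.Re (herglotz_kernel t z) * k t)%:E)
  +i*
  fine (\int[mu]_(t in `[0%R, (2 * pi)%R[%classic) (complex.Im (herglotz_kernel t z) * k t)%:E).

(** Blaschke products (possibly infinite; a zero sequence entry None means
    "no factor"), with a unimodular constant and a zero of order m at 0 *)
Definition blaschke_factor (a z : R[i]) : R[i] :=
  ((normc a)%:C / a) * ((a - z) / (1 - a^* * z)).

Definition is_Blaschke (B : R[i] -> R[i]) : Prop :=
  exists (c : R[i]) (m : nat) (a : nat -> option R[i]),
    normc c = 1 /\
    (forall k w, a k = Some w -> w != 0 /\ in_disc w) /\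
    cvg (series (fun k => match a k with Some w => 1 - normc w | None => 0 end)
          @ \oo) /\
    forall z, in_disc z ->
      ccvg (fun N => c * z ^+ m *
                     \prod_(k < N) match a k with
                                   | Some w => blaschke_factor w z
                                   | None => 1 end) (B z).

Definition is_singular_inner (s : R[i] -> R[i]) : Prop :=
  exists (c : R[i]) (mu : {measure set (measurableTypeR R) -> \bar R}),
    normc c = 1 /\
    mu (~` `[0%R, (2 * pi)%R[%classic) = 0%E /\
    (mu `[0%R, (2 * pi)%R[%classic < +oo)%E /\
    (exists A : set (measurableTypeR R), measurable A /\ lebesgue_measure A = 0%E /\
                      mu (~` A) = 0%E) /\
    forall z, in_disc z -> s z = c * cexp (- herglotz mu (fun=> 1) z).

Definition is_outer (o : R[i] -> R[i]) : Prop :=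
  exists (c : R[i]) (k : R -> R),
    normc c = 1 /\
    lebesgue_measure.-integrable `[0%R, (2 * pi)%R]%classic (EFin \o k) /\
    forall z, in_disc z ->
      o z = c * cexp ((((2 * pi)%R)^-1)%:C * herglotz lebesgue_measure k z).

Definition inner_outer_factorization (f phi s o : R[i] -> R[i]) : Prop :=
  is_Blaschke phi /\ is_singular_inner s /\ is_outer o /\
  forall z, in_disc z -> f z = phi z * s z * o z.

Definition radial_limit (g : R[i] -> R[i]) (t : R) (w : R[i]) : Prop :=
  normc (g (r%:C * expi t) - w) @[r --> 1^'-] --> (0 : R).

Definition is_phase (g : R[i] -> R[i]) (theta : R -> R) : Prop :=
  {ae lebesgue_measure, forall t, 0 < t < (2 * pi)%R ->
       radial_limit g t (expi (theta t))} /\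
  {ae lebesgue_measure, forall t, 0 < t < (2 * pi)%R -> derivable theta t 1} /\
  lebesgue_measure.-integrable `[0%R, (2 * pi)%R]%classic (EFin \o derive1 theta).

Definition mf_value (theta_phi theta_s : R -> R) : R :=
  ((2 * pi)%R)^-1 *
  (fine (\int[lebesgue_measure]_(t in `[0%R, (2 * pi)%R]%classic) (derive1 theta_phi t)%:E)
 + fine (\int[lebesgue_measure]_(t in `[0%R, (2 * pi)%R]%classic) (derive1 theta_s t)%:E)).

Definition mean_frequency_is (f : R[i] -> R[i]) (v : R) : Prop :=
  in_H2 f /\ (exists z, in_disc z /\ f z != 0) /\
  (exists phi s o th_phi th_s, inner_outer_factorization f phi s o /\
       is_phase phi th_phi /\ is_phase s th_s) /\
  (forall phi s o th_phi th_s, inner_outer_factorization f phi s o ->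
       is_phase phi th_phi -> is_phase s th_s -> mf_value th_phi th_s = v).

Definition szego_kernel (n : nat) (a : R[i]) (z : R[i]) : R[i] :=
  (n`!)%:R * z ^+ n / (1 - a^* * z) ^+ n.+1.

Definition normalized_szego_kernel (n : nat) (a : R[i]) (z : R[i]) : R[i] :=
  szego_kernel n a z / (H2_norm (szego_kernel n a))%:C.

Definition TM (n : nat) (a : nat -> R[i]) (z : R[i]) : R[i] :=
  (Num.sqrt (1 - normc (a n) ^+ 2))%:C / (1 - (a n)^* * z) *
  \prod_(1 <= l < n) ((z - a l) / (1 - (a l)^* * z)).

End HardyDefs.

(* Main.v *)
(** All the functions involved have the form
    [f(z) = C * prod_(b in zs) (z - b)/(1 - conj b z) / (1 - conj a z)^p], [C > 0],
    and the mean-frequency is the number of zeros, [size zs].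

    Existence of a factorization: [1 - conj a z] is outer, because the Herglotz
    integral of [ln |1 - conj a e^(it)|] is [2 pi log (1 - conj a z)]; this is
    obtained by replacing [a] with [rho a] and differentiating in [rho].

    Uniqueness: let [f = phi s o].  The zeros of [f] are finite in number, so [phi]
    is a finite Blaschke product; as [|s o|] is bounded above and below on compact
    subsets of the disc, [phi] has the zeros of [f] with multiplicity.  Near the
    unit circle the Poisson integral of the singular measure of [s] is thus the
    Poisson integral of an integrable function [h].  It tends to [0] radially
    almost everywhere because the radial limits of [s] are unimodular, and it is
    uniformly integrable because [h] is integrable; hence the measure has mass [0]
    and [s] is constant.  Finally two phases of the same boundary function differ
    almost everywhere by a multiple of [2 pi], so they have the same derivative at
    almost every point where both are differentiable. *)

Require Import Defs.
From HB Require Import structures.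
From mathcomp Require Import all_boot all_order all_algebra.
From mathcomp Require Import complex.
From mathcomp Require Import all_classical all_reals all_analysis.
From mathcomp Require Import measurable_realfun.
From mathcomp Require Import ring lra.

Set Implicit Arguments.
Unset Strict Implicit.
Unset Printing Implicit Defensive.

Import Order.TTheory GRing.Theory Num.Theory.
Import numFieldNormedType.Exports.

Local Open Scope classical_set_scope.
Local Open Scope complex_scope.
Local Open Scope ring_scope.

Local Notation Re := complex.Re.
Local Notation Im := complex.Im.

(** * Complex modulus, limits and derivatives *)

Section ComplexModulus.
Variable R : realType.
Implicit Types (z w : R[i]) (t x y : R).

(** [mean_frequency_is] quantifies over every factorization and every choice of phases, so
    exhibiting one factorization settles little: the value must be shown independent of all these
    choices. A phase may moreover jump by multiples of 2 pi, so that the integral of its derivative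
    need not be its increment; hence phases are compared with an explicit smooth phase through their
    derivatives.

    The whole argument is reduced to real analysis on circles. Integrals of rational functions of
    e^(it) come from periodic primitives and partial fractions. Orders of zeros are compared by
    inequalities between moduli of finite Blaschke products, in place of expansions at a zero. The
    zeros have to be settled before the singular factor, because [phi] must be cancelled before
    logarithms of moduli can be compared; the cancellation is possible off the zeros, which is why
    the comparison of Poisson integrals lives in an annulus next to the circle.

    In the code [b] stands for the [conj a] of the denominator, and the constant C > 0 is left free
    so that a kernel and its normalization are one case: of the norm, only positivity matters. *)

Lemma normc_ge0 z : 0 <= normc z.
Proof. by case: z => a b; rewrite /= sqrtr_ge0. Qed.

Lemma normc_sqr z : normc z ^+ 2 = Re z ^+ 2 + Im z ^+ 2.
Proof. by case: z => a b /=; rewrite sqr_sqrtr// addr_ge0 ?sqr_ge0. Qed.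

Lemma normcM z w : normc (z * w) = normc z * normc w.
Proof. exact: ComplexField.Normc.normcM. Qed.

Lemma normcV z : normc z^-1 = (normc z)^-1.
Proof. exact: ComplexField.Normc.normcV. Qed.

Lemma normc0 : normc (0 : R[i]) = 0.
Proof. exact: ComplexField.Normc.normc0. Qed.

Lemma normc1 : normc (1 : R[i]) = 1.
Proof. exact: ComplexField.Normc.normc1. Qed.

Lemma normc_eq0 z : (normc z == 0) = (z == 0).
Proof.
apply/eqP/eqP => [|->]; first exact: ComplexField.Normc.eq0_normc.
exact: normc0.
Qed.

Lemma normc_gt0 z : (0 < normc z) = (z != 0).
Proof. by rewrite lt_def normc_ge0 andbT normc_eq0. Qed.

Lemma normcX z n : normc (z ^+ n) = normc z ^+ n.
Proof. by elim: n => [|n IH]; rewrite ?expr0 ?normc1// !exprS normcM IH. Qed.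

Lemma normcN z : normc (- z) = normc z.
Proof. by case: z => a b /=; rewrite !sqrrN. Qed.

Lemma normcJ z : normc z^* = normc z.
Proof. by case: z => a b /=; rewrite sqrrN. Qed.

Lemma le_normcD z w : normc (z + w) <= normc z + normc w.
Proof. by have := ler_normD z w; rewrite !normc_def/= -rmorphD/= lecR; case: z => ? ?; case: w. Qed.

Lemma le_normcB z w : normc (z - w) <= normc z + normc w.
Proof. by rewrite -(normcN w); exact: le_normcD. Qed.

Lemma le_normc_dist z w : normc z - normc w <= normc (z - w).
Proof. by rewrite lerBlDr -{1}(subrK w z); exact: le_normcD. Qed.

Lemma normcR x : normc (x%:C) = `|x|.
Proof. by rewrite /= expr0n/= addr0 sqrtr_sqr. Qed.

Lemma normc_nat n : normc (n%:R : R[i]) = n%:R.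
Proof. by rewrite -(rmorph_nat (real_complex R)) normcR ger0_norm. Qed.

Lemma le_Re_normc z : `|Re z| <= normc z.
Proof.
by case: z => a b /=; rewrite -sqrtr_sqr ler_wsqrtr// lerDl sqr_ge0.
Qed.

Lemma le_Im_normc z : `|Im z| <= normc z.
Proof.
by case: z => a b /=; rewrite -sqrtr_sqr ler_wsqrtr// lerDr sqr_ge0.
Qed.

Lemma le_normc_ReIm z : normc z <= `|Re z| + `|Im z|.
Proof.
rewrite {1}[z]complexE; apply: (le_trans (le_normcD _ _)).
rewrite normcM !normcR lerD2l.
by rewrite (_ : normc 'i%C = 1) ?mul1r//= expr0n/= expr1n add0r sqrtr1.
Qed.

Lemma mulcJ z : z * z^* = (normc z ^+ 2)%:C.
Proof. by rewrite normc_sqr; case: z => a b; simpc; congr (_ +i* _); ring. Qed.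

Lemma ReD z w : Re (z + w) = Re z + Re w. Proof. by case: z; case: w. Qed.
Lemma ImD z w : Im (z + w) = Im z + Im w. Proof. by case: z; case: w. Qed.
Lemma ReN z : Re (- z) = - Re z. Proof. by case: z. Qed.
Lemma ImN z : Im (- z) = - Im z. Proof. by case: z. Qed.
Lemma ReB z w : Re (z - w) = Re z - Re w. Proof. by case: z; case: w. Qed.
Lemma ImB z w : Im (z - w) = Im z - Im w. Proof. by case: z; case: w. Qed.
Lemma ReM z w : Re (z * w) = Re z * Re w - Im z * Im w.
Proof. by case: z; case: w. Qed.
Lemma ImM z w : Im (z * w) = Re z * Im w + Im z * Re w.
Proof. by case: z; case: w. Qed.
Lemma ReJ z : Re z^* = Re z. Proof. by case: z. Qed.
Lemma ImJ z : Im z^* = - Im z. Proof. by case: z. Qed.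
Lemma ReV z : Re z^-1 = Re z / (Re z ^+ 2 + Im z ^+ 2).
Proof. by case: z => a b. Qed.
Lemma ImV z : Im z^-1 = - (Im z / (Re z ^+ 2 + Im z ^+ 2)).
Proof. by case: z => a b. Qed.

Lemma complex_eqP z w : Re z = Re w -> Im z = Im w -> z = w.
Proof. by case: z => a b; case: w => c d /= -> ->. Qed.

Lemma normc_expi t : normc (expi t) = 1.
Proof. by rewrite /expi /= cos2Dsin2 sqrtr1. Qed.

Lemma expi_neq0 t : expi t != 0.
Proof. by rewrite -normc_gt0 normc_expi. Qed.

Lemma expi0 : expi (0 : R) = 1.
Proof. by rewrite /expi cos0 sin0. Qed.

Lemma expiD x y : expi (x + y) = expi x * expi y.
Proof.
by apply: complex_eqP; rewrite ?ReM ?ImM /= ?cosD ?sinD // addrC.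
Qed.

Lemma expiN t : expi (- t) = (expi t)^*.
Proof. by rewrite /expi cosN sinN. Qed.

Lemma expi_conj t : (expi t)^* = (expi t)^-1.
Proof.
apply: (mulfI (expi_neq0 t)).
by rewrite mulcJ normc_expi expr1n divff ?expi_neq0.
Qed.

Lemma expi2pi : expi (2 * pi) = 1 :> R[i].
Proof. by rewrite /expi mulr_natl cos2pi sin2pi. Qed.

Lemma conjcM z w : (z * w)^* = z^* * w^*. Proof. exact: rmorphM. Qed.
Lemma conjcV z : (z^-1)^* = (z^*)^-1. Proof. exact: conjc_inv. Qed.

Lemma normc_polar z : exists t, z = (normc z)%:C * expi t.
Proof.
have [->|z0] := eqVneq z 0; first by exists 0; rewrite normc0 mul0r.
have n0 : normc z != 0 by rewrite normc_eq0.
set a := Re z / normc z; set b := Im z / normc z.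
have ab : a ^+ 2 + b ^+ 2 = 1.
  by rewrite !expr_div_n -mulrDl -normc_sqr divff ?expf_neq0.
have a1 : -1 <= a <= 1.
  by rewrite -ler_norml -(expr_le1 (n := 2))// real_normK ?num_real// -ab lerDl sqr_ge0.
have zE : z = (normc z)%:C * (a +i* b).
  by apply: complex_eqP; rewrite ?ReM ?ImM /= ?mul0r ?subr0 ?addr0 /a /b mulrC divfK.
have sq : Num.sqrt (1 - a ^+ 2) = `|b| by rewrite -ab addrAC subrr add0r sqrtr_sqr.
have [b0|b0] := leP 0 b.
  exists (acos a); rewrite /expi acosK ?in_itv//= sin_acos// sq ger0_norm//.
exists (- acos a); rewrite /expi cosN sinN acosK ?in_itv//= sin_acos// sq ltr0_norm// opprK.
exact: zE.
Qed.

(** The cosine of |x - y| is 1 = cos 0, and cos is injective on [0, pi]. *)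
Lemma expi_inj_small x y : `|x - y| < pi -> expi x = expi y -> x = y.
Proof.
move=> xy e; have : expi (x - y) = 1.
  by rewrite expiD expiN e mulcJ normc_expi expr1n.
case=> c _; apply/eqP; rewrite -subr_eq0 -normr_eq0; apply/eqP.
apply: cos_inj; rewrite ?in_itv/= ?normr_ge0 ?lexx ?pi_ge0 ?ltW//.
by rewrite cos0 -c; case: (ger0P (x - y)) => _; rewrite ?cosN.
Qed.

Lemma cexpD z w : cexp (z + w) = cexp z * cexp w.
Proof.
rewrite /cexp ReD ImD expRD rmorphM/= -/(expi _) expiD /expi.
by rewrite mulrACA.
Qed.

Lemma cexp0 : cexp (0 : R[i]) = 1.
Proof. by rewrite /cexp /= expR0 -/(expi _) expi0 mulr1. Qed.

Lemma normc_cexp z : normc (cexp z) = expR (Re z).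
Proof. by rewrite /cexp normcM normcR -/(expi _) normc_expi mulr1 ger0_norm ?expR_ge0. Qed.

Lemma cexp_neq0 z : cexp z != 0.
Proof. by rewrite -normc_gt0 normc_cexp expR_gt0. Qed.

Lemma cexpN z : cexp (- z) = (cexp z)^-1.
Proof.
by apply: (mulfI (cexp_neq0 z)); rewrite -cexpD subrr cexp0 divff ?cexp_neq0.
Qed.

Lemma cexpMn z n : cexp (n%:R * z) = cexp z ^+ n.
Proof.
elim: n => [|n IH]; first by rewrite mul0r cexp0 expr0.
by rewrite exprSr -natr1 mulrDl mul1r cexpD IH.
Qed.

Lemma cexp_ln x : 0 < x -> cexp (ln x)%:C = x%:C.
Proof. by move=> x0; rewrite /cexp/= lnK// -/(expi _) expi0 mulr1. Qed.

End ComplexModulus.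

Section ComplexLimits.
Variable R : realType.

(** Limits are taken componentwise so that the real limit theorems apply; [ctendsP] gives the
    equivalence with the modulus form used by [ccvg] and [radial_limit]. *)
Definition ctends (T : Type) (F : set_system T) (f : T -> R[i]) (w : R[i]) : Prop :=
  (Re (f x) @[x --> F] --> Re w) /\ (Im (f x) @[x --> F] --> Im w).

Context {T : Type} {F : set_system T} {FF : Filter F}.
Implicit Types (f g : T -> R[i]) (z w : R[i]).

Lemma cvg0_le_norm (f g : T -> R) : g x @[x --> F] --> (0 : R) ->
  (forall x, `|f x| <= g x) -> f x @[x --> F] --> (0 : R).
Proof.
move=> g0 fg; apply: norm_cvg0.
have h : \forall x \near F, 0 <= `|f x| <= g x by near=> x; rewrite normr_ge0 fg.
exact: (squeeze_cvgr h (cvg_cst 0) g0).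
Unshelve. all: by end_near. Qed.

Lemma ctendsP f w : ctends F f w <-> (normc (f x - w) @[x --> F] --> (0 : R)).
Proof.
split=> [[fr fi]|fw]; last first.
  by split; apply/subr_cvg0; apply: (cvg0_le_norm fw) => x /=;
    rewrite -?ReB -?ImB ?le_Re_normc ?le_Im_normc.
have h : (`|Re (f x) - Re w| + `|Im (f x) - Im w|) @[x --> F] --> (0 : R).
  rewrite -[X in _ --> X]addr0; apply: cvgD; rewrite -(normr0 R); apply: cvg_norm;
  exact/subr_cvg0.
apply: (squeeze_cvgr _ (cvg_cst 0) h); near=> x.
by rewrite normc_ge0/= -ReB -ImB le_normc_ReIm.
Unshelve. all: by end_near. Qed.

Lemma ctends_cst z : ctends F (fun=> z) z.
Proof. by split; exact: cvg_cst. Qed.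

Lemma ctendsD f g z w : ctends F f z -> ctends F g w ->
  ctends F (fun x => f x + g x) (z + w).
Proof.
move=> [fr fi] [gr gi]; split.
- by under eq_fun do rewrite ReD; rewrite ReD; exact: cvgD.
- by under eq_fun do rewrite ImD; rewrite ImD; exact: cvgD.
Qed.

Lemma ctendsN f z : ctends F f z -> ctends F (fun x => - f x) (- z).
Proof.
move=> [fr fi]; split.
- by under eq_fun do rewrite ReN; rewrite ReN; exact: cvgN.
- by under eq_fun do rewrite ImN; rewrite ImN; exact: cvgN.
Qed.

Lemma ctendsB f g z w : ctends F f z -> ctends F g w ->
  ctends F (fun x => f x - g x) (z - w).
Proof. by move=> fz gw; apply: ctendsD => //; exact: ctendsN. Qed.

Lemma ctendsJ f z : ctends F f z -> ctends F (fun x => (f x)^*) z^*.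
Proof.
move=> [fr fi]; split.
- by under eq_fun do rewrite ReJ; rewrite ReJ.
- by under eq_fun do rewrite ImJ; rewrite ImJ; exact: cvgN.
Qed.

Lemma ctendsM f g z w : ctends F f z -> ctends F g w ->
  ctends F (fun x => f x * g x) (z * w).
Proof.
move=> [fr fi] [gr gi]; split.
- by under eq_fun do rewrite ReM; rewrite ReM; apply: cvgB; exact: cvgM.
- by under eq_fun do rewrite ImM; rewrite ImM; apply: cvgD; exact: cvgM.
Qed.

Lemma ctendsV f z : z != 0 -> ctends F f z -> ctends F (fun x => (f x)^-1) z^-1.
Proof.
move=> z0 [fr fi].
have n0 : Re z ^+ 2 + Im z ^+ 2 != 0 by rewrite -normc_sqr expf_neq0 ?normc_eq0.
have h : (Re (f x) ^+ 2 + Im (f x) ^+ 2)^-1 @[x --> F] --> (Re z ^+ 2 + Im z ^+ 2)^-1.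
  by apply: cvgV => //; apply: cvgD; rewrite !expr2; exact: cvgM.
split.
- by under eq_fun do rewrite ReV; rewrite ReV; exact: cvgM.
- by under eq_fun do rewrite ImV; rewrite ImV; apply: cvgN; exact: cvgM.
Qed.

Lemma ctendsX f z n : ctends F f z -> ctends F (fun x => f x ^+ n) (z ^+ n).
Proof.
move=> fz; elim: n => [|n IH]; first exact: ctends_cst.
under eq_fun do rewrite exprS; rewrite exprS; exact: ctendsM.
Qed.

Lemma ctends_norm f z : ctends F f z -> normc (f x) @[x --> F] --> normc z.
Proof.
move=> /ctendsP fz; apply/subr_cvg0; apply: (cvg0_le_norm fz) => x /=.
rewrite ler_norml le_normc_dist andbT lerNl opprB.
by rewrite -(normcN (f x - z)) opprB le_normc_dist.
Qed.

Lemma ctends_real (f : T -> R) (x : R) : f y @[y --> F] --> x ->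
  ctends F (fun y => (f y)%:C) x%:C.
Proof. by move=> fx; split => //=; exact: cvg_cst. Qed.

End ComplexLimits.

Lemma ctends_unique (R : realType) (T : Type) (F : set_system T) {FF : ProperFilter F}
    (f : T -> R[i]) z w : ctends F f z -> ctends F f w -> z = w.
Proof.
move=> [a b] [c d]; apply: complex_eqP.
- exact: (cvg_unique _ a c).
- exact: (cvg_unique _ b d).
Qed.

Section ComplexDerivative.
Variable R : realType.
Implicit Types (f g : R -> R[i]) (t : R).

(** Derivatives are taken in a real variable only, the angle or a radius, so a pair of real
    derivatives suffices. *)
Definition cderiv f t (d : R[i]) : Prop :=
  is_derive t 1 (fun x => Re (f x)) (Re d) /\ is_derive t 1 (fun x => Im (f x)) (Im d).

Lemma cderiv_eq f t d d' : cderiv f t d -> d = d' -> cderiv f t d'.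
Proof. by move=> + <-. Qed.

Lemma cderiv_cst z t : cderiv (fun=> z) t 0.
Proof. by split; exact: is_derive_cst. Qed.

Lemma cderivD f g t d e : cderiv f t d -> cderiv g t e ->
  cderiv (fun x => f x + g x) t (d + e).
Proof.
move=> [fr fi] [gr gi]; split.
- by under eq_fun do rewrite ReD; rewrite ReD; exact: is_deriveD.
- by under eq_fun do rewrite ImD; rewrite ImD; exact: is_deriveD.
Qed.

Lemma cderivM f g t d e : cderiv f t d -> cderiv g t e ->
  cderiv (fun x => f x * g x) t (d * g t + f t * e).
Proof.
move=> [fr fi] [gr gi]; split.
- under eq_fun do rewrite ReM; rewrite ReD !ReM.
  refine (is_derive_eq (is_deriveB (is_deriveM fr gr) (is_deriveM fi gi)) _).
  by rewrite /GRing.scale/=; ring.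
- under eq_fun do rewrite ImM; rewrite ImD !ImM.
  refine (is_derive_eq (is_deriveD (is_deriveM fr gi) (is_deriveM fi gr)) _).
  by rewrite /GRing.scale/=; ring.
Qed.

Lemma cderivN f t d : cderiv f t d -> cderiv (fun x => - f x) t (- d).
Proof.
move=> [fr fi]; split.
- by under eq_fun do rewrite ReN; rewrite ReN; exact: is_deriveN.
- by under eq_fun do rewrite ImN; rewrite ImN; exact: is_deriveN.
Qed.

Lemma cderivZ z f t d : cderiv f t d -> cderiv (fun x => z * f x) t (z * d).
Proof.
move=> fd; apply: cderiv_eq; first by apply: cderivM fd; exact: cderiv_cst.
by rewrite mul0r add0r.
Qed.

Lemma cderivV f t d : f t != 0 -> cderiv f t d ->
  cderiv (fun x => (f x)^-1) t (- (d / f t ^+ 2)).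
Proof.
move=> f0 [fr fi].
have n0 : Re (f t) ^+ 2 + Im (f t) ^+ 2 != 0.
  by rewrite -normc_sqr expf_neq0 ?normc_eq0.
have nd : is_derive t 1 (fun x => Re (f x) ^+ 2 + Im (f x) ^+ 2)
    (2 * (Re (f t) * Re d + Im (f t) * Im d)).
  refine (is_derive_eq (is_deriveD (is_deriveX 2 fr) (is_deriveX 2 fi)) _).
  by rewrite /GRing.scale/= expr1; ring.
have vd := @is_deriveV R (fun x => Re (f x) ^+ 2 + Im (f x) ^+ 2) t _ 1 n0 nd.
have e : (f t ^+ 2)^-1 = ((f t)^-1) ^+ 2 by rewrite exprVn.
split.
- under eq_fun do rewrite ReV.
  refine (is_derive_eq (is_deriveM fr vd) _).
  rewrite ReN e expr2 !(ReM, ImM) ReV ImV /GRing.scale/=.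
  by field; rewrite n0.
- under eq_fun do rewrite ImV.
  refine (is_derive_eq (is_deriveN (is_deriveM fi vd)) _).
  rewrite ImN e expr2 !(ReM, ImM) ReV ImV /GRing.scale/=.
  by field; rewrite n0.
Qed.

Lemma cderiv_expi t : cderiv (@expi R) t ('i%C * expi t).
Proof.
split; rewrite ?ReM ?ImM /expi /= !mul0r ?mul1r ?sub0r ?add0r.
- exact: is_derive_cos.
- exact: is_derive_sin.
Qed.

Lemma cderiv_ctends f t d : cderiv f t d -> ctends (nbhs t) f (f t).
Proof.
by move=> [fr fi]; split; apply: differentiable_continuous; apply/derivable1_diffP; case: fr; case: fi.
Qed.

End ComplexDerivative.

(** * Logarithm and integrals over the circle *)

Section ComplexLogarithm.
Variable R : realType.
Implicit Types (w z b : R[i]).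

(** The principal logarithm on the right half-plane, where atan (Im / Re) is the argument. It is
    applied to 1 - w with |w| < 1. *)
Definition clog w : R[i] := ln (normc w) +i* atan (Im w / Re w).

Lemma ln_normc w : ln (normc w) = 2^-1 * ln (Re w ^+ 2 + Im w ^+ 2).
Proof.
rewrite -normc_sqr; have [->|w0] := eqVneq w 0.
  by rewrite normc0 expr0n/= ln0// mulr0.
by rewrite lnXn ?normc_gt0// mulr2n; field.
Qed.

Lemma cexp_clog w : 0 < Re w -> cexp (clog w) = w.
Proof.
move=> w0; have nw0 : 0 < normc w.
  by rewrite normc_gt0; apply: contraTneq w0 => ->; rewrite ltxx.
rewrite /cexp /clog/= lnK//.
have e : Num.sqrt (1 + (Im w / Re w) ^+ 2) = normc w / Re w.
  rewrite -[RHS]ger0_norm ?divr_ge0 ?ltW// -sqrtr_sqr; congr Num.sqrt.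
  rewrite !expr_div_n normc_sqr mulrDl divff//.
  by rewrite expf_neq0// gt_eqF.
have c : cos (atan (Im w / Re w)) = Re w / normc w.
  by rewrite cos_atan e invf_div.
have s : sin (atan (Im w / Re w)) = Im w / normc w.
  have := atanK (Im w / Re w); rewrite /tan c => /(canRL (divfK _)) ->.
    by field; rewrite !gt_eqF.
  by rewrite mulf_neq0 ?invr_eq0// gt_eqF.
rewrite c s; apply: complex_eqP; rewrite ?ReM ?ImM /= mul0r ?subr0 ?addr0;
  by rewrite mulrC divfK// gt_eqF.
Qed.

Lemma clog1 : clog 1 = 0.
Proof. by rewrite /clog normc1 ln1/= mul0r atan0. Qed.

Lemma cderiv_clog (f : R -> R[i]) t d : 0 < Re (f t) -> cderiv f t d ->
  cderiv (fun x => clog (f x)) t (d / f t).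
Proof.
move=> f0 [fr fi].
have u0 : 0 < Re (f t) ^+ 2 + Im (f t) ^+ 2.
  by rewrite ltr_pwDl ?sqr_ge0// exprn_gt0.
split.
- rewrite [X in is_derive _ _ X](_ : _ =
    (fun x => 2^-1 * ln (Re (f x) ^+ 2 + Im (f x) ^+ 2))); last first.
    by apply/funext => x /=; rewrite ln_normc.
  have nd := is_deriveD (is_deriveX 2 fr) (is_deriveX 2 fi).
  have ld := is_derive1_comp (f := @ln R) (g := (fun x => Re (f x) ^+ 2 + Im (f x) ^+ 2))
    (is_derive1_ln u0) nd.
  refine (is_derive_eq (is_deriveZ 2^-1 ld) _).
  rewrite ReM ReV ImV /GRing.scale/= !expr1.
  by field; rewrite gt_eqF.
- have vd := is_deriveV (lt0r_neq0 f0) fr.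
  have ad := is_derive1_comp (f := @atan R) (g := (fun x => Im (f x) / Re (f x)))
    (is_derive1_atan _) (is_deriveM fi vd).
  refine (is_derive_eq ad _).
  rewrite ImM ReV ImV /GRing.scale/=.
  by field; rewrite !gt_eqF.
Qed.

Lemma Re_1B_gt0 w : normc w < 1 -> 0 < Re (1 - w).
Proof.
move=> w1; rewrite ReB/= subr_gt0 (le_lt_trans _ w1)//.
by rewrite (le_trans _ (le_Re_normc w))// ler_norm.
Qed.

Lemma sub1_neq0 w : normc w < 1 -> 1 - w != 0.
Proof. by move=> /Re_1B_gt0; apply: contraTneq => ->; rewrite ltxx. Qed.

End ComplexLogarithm.

Lemma Re_conj (R : realType) (z : R[i]) : (Re z)%:C = (z + z^* ) / 2.
Proof. exact: ReJ_add. Qed.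

(** * Integrals of rational functions over the unit circle *)

Section CircleMean.
Variable R : realType.
Local Notation mu := (@lebesgue_measure R).
Implicit Types (f g : R -> R[i]) (z w b c : R[i]).
Local Notation I02pi := (`[0%R, (2 * pi)%R]%classic).

Lemma twopi_gt0 : 0 < 2 * pi :> R.
Proof. by rewrite mulr_gt0// pi_gt0. Qed.

Definition ccont f := forall t, ctends (nbhs t) f (f t).

(** No factor 1/(2 pi) is included, which explains the 2 pi in the values below. *)
Definition circ f : R[i] :=
  (\int[mu]_(t in I02pi) Re (f t)) +i* (\int[mu]_(t in I02pi) Im (f t)).

Lemma cont_integrable (f : R -> R) : continuous f -> mu.-integrable I02pi (EFin \o f).
Proof.
move=> cf; apply: continuous_compact_integrable; first exact: segment_compact.
exact: continuous_subspaceT.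
Qed.

Lemma ccont_Re f : ccont f -> continuous (fun t => Re (f t)).
Proof. by move=> cf t; case: (cf t). Qed.

Lemma ccont_Im f : ccont f -> continuous (fun t => Im (f t)).
Proof. by move=> cf t; case: (cf t). Qed.

Lemma ccont_cst z : ccont (fun=> z). Proof. by move=> t; exact: ctends_cst. Qed.
Lemma ccontD f g : ccont f -> ccont g -> ccont (fun t => f t + g t).
Proof. by move=> cf cg t; exact: ctendsD. Qed.
Lemma ccontB f g : ccont f -> ccont g -> ccont (fun t => f t - g t).
Proof. by move=> cf cg t; exact: ctendsB. Qed.
Lemma ccontM f g : ccont f -> ccont g -> ccont (fun t => f t * g t).
Proof. by move=> cf cg t; exact: ctendsM. Qed.
Lemma ccontV f : (forall t, f t != 0) -> ccont f -> ccont (fun t => (f t)^-1).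
Proof. by move=> f0 cf t; exact: ctendsV. Qed.
Lemma ccont_expi : ccont (@expi R).
Proof. by move=> t; apply: cderiv_ctends; exact: cderiv_expi. Qed.
Lemma ccont_real (f : R -> R) : continuous f -> ccont (fun t => (f t)%:C).
Proof. by move=> cf t; apply: ctends_real; exact: cf. Qed.

Lemma circD f g : ccont f -> ccont g -> circ (fun t => f t + g t) = circ f + circ g.
Proof.
move=> cf cg; apply: complex_eqP; rewrite ?ReD ?ImD /=.
- under eq_Rintegral do rewrite ReD.
  by rewrite RintegralD//; apply: cont_integrable; exact: ccont_Re.
- under eq_Rintegral do rewrite ImD.
  by rewrite RintegralD//; apply: cont_integrable; exact: ccont_Im.
Qed.

Lemma circZ z f : ccont f -> circ (fun t => z * f t) = z * circ f.
Proof.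
move=> cf.
have ir := cont_integrable (ccont_Re cf); have ii := cont_integrable (ccont_Im cf).
have irc k : mu.-integrable I02pi (EFin \o (fun t => k * Re (f t))).
  by apply: cont_integrable => t; apply: cvgM; [exact: cvg_cst|exact: (ccont_Re cf)].
have iic k : mu.-integrable I02pi (EFin \o (fun t => k * Im (f t))).
  by apply: cont_integrable => t; apply: cvgM; [exact: cvg_cst|exact: (ccont_Im cf)].
apply: complex_eqP; rewrite ?ReM ?ImM /=.
- under eq_Rintegral do rewrite ReM.
  by rewrite RintegralB// !RintegralZl.
- under eq_Rintegral do rewrite ImM.
  by rewrite RintegralD// !RintegralZl.
Qed.

Lemma circB f g : ccont f -> ccont g -> circ (fun t => f t - g t) = circ f - circ g.
Proof.
move=> cf cg; rewrite -(mulN1r (circ g)) -circZ// -circD//.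
  by congr circ; apply/funext => t; rewrite mulN1r.
by apply: ccontM => //; exact: ccont_cst.
Qed.

Lemma circJ f : ccont f -> circ (fun t => (f t)^*) = (circ f)^*.
Proof.
move=> cf; apply: complex_eqP; rewrite ?ReJ ?ImJ /=.
- by under eq_Rintegral do rewrite ReJ.
- under eq_Rintegral do rewrite ImJ -mulN1r.
  by rewrite RintegralZl ?mulN1r//; apply: cont_integrable; exact: ccont_Im.
Qed.

Lemma lebesgue_I02pi : mu `[0%R, (2 * pi)%R]%classic = (2 * pi)%:E.
Proof. by rewrite lebesgue_measure_itv/= lte_fin twopi_gt0 sube0. Qed.

Lemma circ_cst z : circ (fun=> z) = (2 * pi)%:C * z.
Proof.
by apply: complex_eqP; rewrite ?ReM ?ImM /= Rintegral_cst//= (lebesgue_I02pi)/=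
  mul0r ?subr0 ?addr0 mulrC.
Qed.

Lemma FTC_circle (F f : R -> R) : continuous f -> (forall t : R, is_derive t 1 F (f t)) ->
  \int[mu]_(t in I02pi) f t = F (2 * pi) - F 0.
Proof.
move=> cf dF; rewrite /Rintegral (@continuous_FTC2 _ f F)//.
- exact: twopi_gt0.
- exact: continuous_subspaceT.
- have cF t : F x @[x --> t] --> F t.
    by apply: differentiable_continuous; apply/derivable1_diffP; case: (dF t).
  split.
  + by move=> t _; case: (dF t).
  + by apply: cvg_at_right_filter; exact: cF.
  + by apply: cvg_at_left_filter; exact: cF.
- by move=> t _; rewrite derive1E; exact: derive_val.
Qed.

Lemma circ_deriv F f : (forall t, cderiv F t (f t)) -> ccont f ->
  circ f = F (2 * pi) - F 0.
Proof.
move=> dF cf; apply: complex_eqP; rewrite ?ReB ?ImB /=.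
- apply: (@FTC_circle (fun t => Re (F t))); first exact: ccont_Re.
  by move=> t; case: (dF t).
- apply: (@FTC_circle (fun t => Im (F t))); first exact: ccont_Im.
  by move=> t; case: (dF t).
Qed.

Lemma normcM_expi b t : normc (b * expi t) = normc b.
Proof. by rewrite normcM normc_expi mulr1. Qed.

Lemma sub1_expi_neq0 b t : normc b < 1 -> 1 - b * expi t != 0.
Proof. by move=> b1; apply: sub1_neq0; rewrite normcM_expi. Qed.

Lemma expi_sub_neq0 z t : normc z < 1 -> expi t - z != 0.
Proof.
by rewrite subr_eq0 => z1; apply: contraTneq z1 => <-; rewrite normc_expi ltxx.
Qed.

Lemma ccont_sub1_inv b : normc b < 1 -> ccont (fun t => (1 - b * expi t)^-1).
Proof.
move=> b1; apply: ccontV => [t|]; first exact: sub1_expi_neq0.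
by apply: ccontB; [exact: ccont_cst|apply: ccontM; [exact: ccont_cst|exact: ccont_expi]].
Qed.

Lemma ccont_sub_inv z : normc z < 1 -> ccont (fun t => (expi t - z)^-1).
Proof.
move=> z1; apply: ccontV => [t|]; first exact: expi_sub_neq0.
by apply: ccontB; [exact: ccont_expi|exact: ccont_cst].
Qed.

Lemma iC_neq0 : 'i%C != 0 :> R[i].
Proof. by rewrite eq_complex/= oner_eq0 andbF. Qed.

Lemma cderiv_sub1_expi b t : cderiv (fun x => 1 - b * expi x) t (- (b * ('i%C * expi t))).
Proof.
apply: cderiv_eq.
  by apply: cderivD; [exact: cderiv_cst|apply: cderivN; apply: cderivZ; exact: cderiv_expi].
by rewrite add0r.
Qed.

(** The mean of w/(1 - b w) is its value at 0. The primitive - log(1 - b e^(it)) / (b i) is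
    periodic; as it divides by b, the case b = 0 is separate. *)
Lemma circ_outer_pole b : normc b < 1 -> circ (fun t => expi t / (1 - b * expi t)) = 0.
Proof.
move=> b1; have cf : ccont (fun t => expi t / (1 - b * expi t)).
  by apply: ccontM; [exact: ccont_expi|exact: ccont_sub1_inv].
have [b0|b0] := eqVneq b 0.
  rewrite (@circ_deriv (fun t => 'i%C^-1 * expi t)) ?expi0 ?expi2pi ?subrr// => t.
  apply: cderiv_eq; first by apply: cderivZ; exact: cderiv_expi.
  by rewrite mulKf ?iC_neq0// b0 mul0r subr0 divr1.
rewrite (@circ_deriv (fun t => - (b * 'i%C)^-1 * clog (1 - b * expi t)))
  ?expi0 ?expi2pi ?subrr// => t.
apply: cderiv_eq.
  apply: cderivZ; apply: cderiv_clog; last exact: cderiv_sub1_expi.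
  by apply: Re_1B_gt0; rewrite normcM_expi.
by rewrite /=; field; rewrite b0 iC_neq0 sub1_expi_neq0.
Qed.

Lemma circ_sub1_inv b : normc b < 1 -> circ (fun t => (1 - b * expi t)^-1) = (2 * pi)%:C.
Proof.
move=> b1.
rewrite (_ : (fun _ => _) = (fun t => 1 + b * (expi t / (1 - b * expi t)))); last first.
  by apply/funext => t; field; rewrite sub1_expi_neq0.
have cf : ccont (fun t => expi t / (1 - b * expi t)).
  by apply: ccontM; [exact: ccont_expi|exact: ccont_sub1_inv].
rewrite circD; [|exact: ccont_cst|by apply: ccontM => //; exact: ccont_cst].
by rewrite circ_cst circZ// circ_outer_pole// mulr0 addr0 mulr1.
Qed.

(** On the circle, conjugation is inversion, so it exchanges a pole outside the disc with one
    inside. Integrals with inner poles thus become conjugates of integrals with outer poles. *)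
Lemma conj_outer_pole z t :
  (expi t / (1 - z^* * expi t))^* = (expi t - z)^-1.
Proof.
rewrite conjcM conjcV rmorphB rmorph1 rmorphM/= conjCK expi_conj.
(* At [expi t = z] both denominators vanish, and both sides are 0 because the inverse of 0 is 0. *)
have e0 := expi_neq0 t; have [<-|d0] := eqVneq (expi t) z.
  by rewrite divff// subrr invr0 mulr0 subrr invr0.
have d1 : 1 - z / expi t != 0.
  rewrite (_ : 1 - _ = (expi t - z) / expi t); last by field.
  by rewrite mulf_neq0 ?invr_eq0// subr_eq0.
by field; rewrite e0 subr_eq0 d0 !andbT.
Qed.

Lemma circ_inner_pole z : normc z < 1 -> circ (fun t => (expi t - z)^-1) = 0.
Proof.
move=> z1; under eq_fun do rewrite -conj_outer_pole.
rewrite circJ; first by rewrite circ_outer_pole ?rmorph0 ?normcJ.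
by apply: ccontM; [exact: ccont_expi|apply: ccont_sub1_inv; rewrite normcJ].
Qed.

(** For b != c, partial fractions lead back to single poles. For b = c != 0 the double pole w/(1 - c
    w)^2 is the derivative in t of w/(i (1 - c w)); for c = 0 the primitive is w^2/(2 i). *)
Lemma circ_outer_pole2 b c : normc b < 1 -> normc c < 1 ->
  circ (fun t => (expi t / (1 - b * expi t)) * (expi t / (1 - c * expi t))) = 0.
Proof.
move=> b1 c1.
have cf x : normc x < 1 -> ccont (fun t => expi t / (1 - x * expi t)).
  by move=> x1; apply: ccontM; [exact: ccont_expi|exact: ccont_sub1_inv].
have [->|bc] := eqVneq b c; last first.
  have bc0 : b - c != 0 by rewrite subr_eq0.
  rewrite (_ : (fun _ => _) = (fun t => (b - c)^-1 *
      (expi t / (1 - b * expi t) - expi t / (1 - c * expi t)))); last first.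
    by apply/funext => t; field; rewrite bc0 !sub1_expi_neq0.
  rewrite circZ; last by apply: ccontB; exact: cf.
  by rewrite circB ?circ_outer_pole ?subrr ?mulr0//; exact: cf.
have cf2 : ccont (fun t => (expi t / (1 - c * expi t)) * (expi t / (1 - c * expi t))).
  by apply: ccontM; exact: cf.
have [c0|c0] := eqVneq c 0.
  rewrite (@circ_deriv (fun t => (2 * 'i%C)^-1 * (expi t * expi t)))
    ?expi0 ?expi2pi ?subrr// => t.
  apply: cderiv_eq; first by apply: cderivZ; apply: cderivM; exact: cderiv_expi.
  by rewrite c0; field; rewrite iC_neq0.
have cd : ccont (fun t => expi t / (1 - c * expi t) / (1 - c * expi t)).
  by apply: ccontM; [exact: cf|exact: ccont_sub1_inv].
rewrite (_ : (fun _ => _) = (fun t => c^-1 *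
    (expi t / (1 - c * expi t) / (1 - c * expi t) - expi t / (1 - c * expi t)))); last first.
  by apply/funext => t; field; rewrite c0 !sub1_expi_neq0.
rewrite circZ; last by apply: ccontB => //; exact: cf.
rewrite circB//; last exact: cf.
rewrite circ_outer_pole// subr0.
rewrite (@circ_deriv (fun t => 'i%C^-1 * (expi t / (1 - c * expi t))))
  ?expi0 ?expi2pi ?subrr ?mulr0// => t.
apply: cderiv_eq.
  apply: cderivZ; apply: cderivM; first exact: cderiv_expi.
  by apply: cderivV; [exact: sub1_expi_neq0|exact: cderiv_sub1_expi].
by rewrite /=; field; rewrite sub1_expi_neq0// iC_neq0.
Qed.

Lemma circ_inner_pole2 z w : normc z < 1 -> normc w < 1 ->
  circ (fun t => (expi t - z)^-1 * (expi t - w)^-1) = 0.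
Proof.
move=> z1 w1; under eq_fun do rewrite -!conj_outer_pole -conjcM.
have cf x : normc x < 1 -> ccont (fun t => expi t / (1 - x^* * expi t)).
  by move=> x1; apply: ccontM; [exact: ccont_expi|apply: ccont_sub1_inv; rewrite normcJ].
rewrite circJ; first by rewrite circ_outer_pole2 ?rmorph0 ?normcJ.
by apply: ccontM; exact: cf.
Qed.

Lemma normcM_lt1 z w : normc z < 1 -> normc w < 1 -> normc (z * w) < 1.
Proof. by move=> z1 w1; rewrite normcM mulr_ilt1 ?normc_ge0. Qed.

(** Cauchy's formula for 1/(1 - b w) at the point z: partial fractions separate the inner pole,
    which contributes 0, from the outer one. *)
Lemma circ_cauchy z b : normc z < 1 -> normc b < 1 ->
  circ (fun t => (expi t - z)^-1 * (expi t / (1 - b * expi t))) = (2 * pi)%:C / (1 - b * z).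
Proof.
move=> z1 b1; have bz := sub1_neq0 (normcM_lt1 b1 z1).
rewrite (_ : (fun _ => _) = (fun t => (1 - b * z)^-1 *
    (z * (expi t - z)^-1 + (1 - b * expi t)^-1))); last first.
  by apply/funext => t; field; rewrite bz sub1_expi_neq0// expi_sub_neq0.
have ci := ccont_sub_inv z1; have co := ccont_sub1_inv b1.
have czi : ccont (fun t => z * (expi t - z)^-1) by apply: ccontM => //; exact: ccont_cst.
rewrite circZ; last exact: ccontD.
by rewrite circD// circZ// circ_inner_pole// circ_sub1_inv// mulr0 add0r mulrC.
Qed.

Lemma herglotz_kernelE t z : normc z < 1 ->
  herglotz_kernel t z = 1 + 2 * z * (expi t - z)^-1.
Proof. by move=> z1; rewrite /herglotz_kernel; field; rewrite expi_sub_neq0. Qed.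

Lemma ccont_herglotz_kernel z : normc z < 1 -> ccont (fun t => herglotz_kernel t z).
Proof.
move=> z1; under eq_fun do rewrite herglotz_kernelE//.
apply: ccontD; first exact: ccont_cst.
by apply: ccontM; [exact: ccont_cst|exact: ccont_sub_inv].
Qed.

(** The Schwarz formula for g(w) = c w/(1 - b w), which vanishes at 0. Writing Re g as (g + conj
    g)/2 gives four products of simple poles, and only the one mixing an inner with an outer pole
    has a nonzero integral. *)
Lemma circ_herglotz_rational z b c : normc z < 1 -> normc b < 1 ->
  circ (fun t => herglotz_kernel t z * (Re (c * (expi t / (1 - b * expi t))))%:C) =
  (2 * pi)%:C * (c * z / (1 - b * z)).
Proof.
move=> z1 b1; have b1' : normc b^* < 1 by rewrite normcJ.
have cf : ccont (fun t => expi t / (1 - b * expi t)).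
  by apply: ccontM; [exact: ccont_expi|exact: ccont_sub1_inv].
have ci := ccont_sub_inv z1; have cb := ccont_sub_inv b1'.
rewrite (_ : (fun _ => _) = (fun t =>
   (2^-1 * c) * (expi t / (1 - b * expi t)) +
   ((c * z) * ((expi t - z)^-1 * (expi t / (1 - b * expi t))) +
   ((2^-1 * c^*) * (expi t - b^*)^-1 +
    (c^* * z) * ((expi t - z)^-1 * (expi t - b^*)^-1))))); last first.
  apply/funext => t; rewrite herglotz_kernelE// Re_conj conjcM.
  rewrite -{2}(conjCK b) conj_outer_pole.
  by field; rewrite sub1_expi_neq0// !expi_sub_neq0.
have cM k f : ccont f -> ccont (fun t => k * f t).
  by move=> ?; apply: ccontM => //; exact: ccont_cst.
have cI := ccontM ci cf; have cII := ccontM ci cb.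
rewrite circD; [|exact: cM|by apply: ccontD; [exact: cM|apply: ccontD; exact: cM]].
rewrite circD; [|exact: cM|by apply: ccontD; exact: cM].
rewrite circD; [|exact: cM|exact: cM].
rewrite !circZ// circ_outer_pole// circ_cauchy// circ_inner_pole// circ_inner_pole2//.
by rewrite !mulr0 !addr0 add0r mulrA [RHS]mulrC -!mulrA; congr (_ * (_ * _)); rewrite mulrC.
Qed.

End CircleMean.

(** * Outer functions *)

Section OuterRepresentation.
Variable R : realType.
Local Notation mu := (@lebesgue_measure R).
Local Notation I02pi := (`[0%R, (2 * pi)%R]%classic).
Implicit Types (z b : R[i]).

Lemma cvg_ln (T : Type) (F : set_system T) {FF : Filter F} (f : T -> R) (x : R) :
  0 < x -> f y @[y --> F] --> x -> ln (f y) @[y --> F] --> ln x.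
Proof. by move=> x0 fx; apply: continuous_cvg => //; exact: continuous_ln. Qed.

Lemma cont_ln_normc (f : R -> R[i]) : ccont f -> (forall t, f t != 0) ->
  continuous (fun t => ln (normc (f t))).
Proof.
move=> cf f0 t; apply: cvg_ln; first by rewrite normc_gt0.
by apply: ctends_norm; exact: cf.
Qed.

Lemma ccont_sub1 b : ccont (fun t => 1 - b * expi t).
Proof.
by apply: ccontB; [exact: ccont_cst|apply: ccontM; [exact: ccont_cst|exact: ccont_expi]].
Qed.

Lemma cderiv_clog_sub1 b w (rho : R) : normc (rho%:C * b * w) < 1 ->
  cderiv (fun r : R => clog (1 - r%:C * b * w)) rho (- (b * w) / (1 - rho%:C * b * w)).
Proof.
move=> h; apply: cderiv_clog; first exact: Re_1B_gt0.
apply: (@cderiv_eq _ _ _ (0 + - ((1 : R)%:C * (b * w) + rho%:C * 0))); last first.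
  by rewrite mulr0 addr0 mul1r add0r.
under eq_fun do rewrite -mulrA.
apply: cderivD; first exact: cderiv_cst.
apply: cderivN; apply: (@cderivM _ (fun r : R => r%:C) (fun=> b * w)); last exact: cderiv_cst.
by split; [exact: is_derive_id|exact: is_derive_cst].
Qed.

(** Differentiation under the integral sign: for |r| < q the modulus of 1 - r b e^(it) stays above 1
    - q |b| > 0, whence the dominating function [G]. The weight [k] will be the real or the
    imaginary part of the Herglotz kernel. *)
Lemma is_derive_mean_ln (k : R -> R) b (q rho : R) : continuous k ->
  normc b * q < 1 -> rho \in `](- q), q[ ->
  is_derive rho 1 (fun r => \int[mu]_(t in I02pi) (k t * ln (normc (1 - r%:C * b * expi t))))
   (\int[mu]_(t in I02pi) (k t * Re (- (b * expi t) / (1 - rho%:C * b * expi t)))).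
Proof.
move=> ck bq rq.
have nb r : r \in `](- q), q[ -> normc (r%:C * b) <= q * normc b.
  rewrite in_itv/= -ltr_norml => rr.
  by rewrite normcM normcR ler_wpM2r ?normc_ge0// ltW.
have nb1 r : r \in `](- q), q[ -> normc (r%:C * b) < 1.
  by move=> /nb rr; rewrite (le_lt_trans rr)// mulrC.
pose f r t := k t * ln (normc (1 - r%:C * b * expi t)).
have df r t : r \in `](- q), q[ ->
    is_derive r 1 (f ^~ t) (k t * Re (- (b * expi t) / (1 - r%:C * b * expi t))).
  move=> rr; have h : normc (r%:C * b * expi t) < 1 by rewrite normcM_expi nb1.
  by have [hd _] := cderiv_clog_sub1 h; exact: (is_deriveZ (k t) hd).
have d1 r t : r \in `](- q), q[ ->
    partial1of2 f r t = k t * Re (- (b * expi t) / (1 - r%:C * b * expi t)).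
  by move=> rr; rewrite /partial1of2 derive1E; have := df r t rr => ?; exact: derive_val.
pose G t := `|k t| * (normc b / (1 - q * normc b)).
have q1 : 0 < 1 - q * normc b by rewrite subr_gt0 mulrC.
have G0 t : 0 <= G t by rewrite mulr_ge0// divr_ge0 ?normc_ge0// ltW.
have intf r : `](- q), q[%classic r -> mu.-integrable I02pi (EFin \o f r).
  move=> rr; apply: cont_integrable => t; apply: cvgM; first exact: ck.
  apply: cont_ln_normc; first exact: ccont_sub1.
  by move=> s; apply: sub1_expi_neq0; exact: nb1.
have derf r t : `](- q), q[%classic r -> I02pi t -> derivable (f ^~ t) r 1.
  by move=> rr _; case: (df r t rr).
have intG : mu.-integrable I02pi (EFin \o G).
  apply: cont_integrable => t; apply: cvgM; last exact: cvg_cst.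
  by apply: cvg_norm; exact: ck.
have Gub r t : `](- q), q[%classic r -> I02pi t -> `|partial1of2 f r t| <= G t.
  move=> rr _; rewrite d1// normrM ler_wpM2l//.
  apply: (le_trans (le_Re_normc _)); rewrite normcM normcN normcM_expi normcV.
  rewrite ler_wpM2l ?normc_ge0// lef_pV2 ?posrE//; last first.
    by rewrite normc_gt0; apply: sub1_expi_neq0; exact: nb1.
  apply: le_trans (le_normc_dist _ _); rewrite normc1 normcM_expi lerD2l lerN2.
  exact: nb.
have Irho : `](- q), q[%classic rho by [].
have mI : measurable (I02pi : set R) by [].
apply: DeriveDef.
  exact: (@derivable_under_integral R _ _ mu f I02pi mI rho (- q) q Irho intf derf G G0 intG Gub).
rewrite -derive1E (@differentiation_under_integral R _ _ mu f I02pi mI rho (- q) q Irho intf derf G G0 intG Gub).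
by apply: eq_Rintegral => t _; rewrite d1.
Qed.

(** Two-sided derivatives on a neighbourhood of [0, 1] supply the continuity at the endpoints that
    the mean value theorem asks for. *)
Lemma is_derive0_segment (g : R -> R) (q : R) : 1 < q ->
  (forall x, x \in `](- q), q[ -> is_derive x 1 g 0) -> g 1 = g 0.
Proof.
move=> q1 dg.
have sub x : x \in `[0, 1] -> x \in `](- q), q[.
  by rewrite !in_itv/= => /andP[x0 x1]; apply/andP; split; lra.
have dg01 (x : R) : x \in `]0, 1[ -> is_derive x 1 g ((cst 0 : R -> R) x).
  by move=> x01; apply: dg; apply: sub; move: x01; rewrite !in_itv/= => /andP[/ltW -> /ltW ->].
have cg : {within `[(0 : R), 1], continuous g}.
  by apply: derivable_within_continuous => x /sub /dg h; case: h.
have [c _] := MVT (@ltr01 R) dg01 cg.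
by move/eqP; rewrite mul0r subr_eq0 => /eqP.
Qed.

Lemma circ_herglotz z : normc z < 1 -> circ (fun t => herglotz_kernel t z) = (2 * pi)%:C.
Proof.
move=> z1; under eq_fun do rewrite herglotz_kernelE//.
have ci := ccont_sub_inv z1.
rewrite circD; [|exact: ccont_cst|by apply: ccontM => //; exact: ccont_cst].
by rewrite circ_cst circZ// circ_inner_pole// mulr1 mulr0 addr0.
Qed.

Lemma circ_mulr_real (f : R -> R[i]) (k : R -> R) :
  circ (fun t => f t * (k t)%:C) =
  (\int[mu]_(t in I02pi) (Re (f t) * k t)) +i* (\int[mu]_(t in I02pi) (Im (f t) * k t)).
Proof.
apply: complex_eqP => /=; apply: eq_Rintegral => t _.
- by rewrite ReM/= mulr0 subr0.
- by rewrite ImM/= mulr0 add0r.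
Qed.

(* Both sides vanish when b is replaced by 0; replacing it by [rho * b] and
   differentiating in [rho] leaves an integral of a rational function. *)
Lemma circ_herglotz_ln z b : normc z < 1 -> normc b < 1 ->
  circ (fun t => herglotz_kernel t z * (ln (normc (1 - b * expi t)))%:C) =
  (2 * pi)%:C * clog (1 - b * z).
Proof.
move=> z1 b1.
(* Any q with q > 1 and q |b| < 1 would do; this choice also covers b = 0. *)
pose q := 2 / (1 + normc b).
have nb0 := normc_ge0 b.
have q1 : 1 < q by rewrite /q ltr_pdivlMr ?mul1r; lra.
have bq : normc b * q < 1 by rewrite /q mulrA ltr_pdivrMr ?mul1r; lra.
have ckr := ccont_Re (ccont_herglotz_kernel z1).
have cki := ccont_Im (ccont_herglotz_kernel z1).
pose Phi (r : R) := circ (fun t => herglotz_kernel t z * (ln (normc (1 - r%:C * b * expi t)))%:C).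
pose Psi (r : R) := Phi r - (2 * pi)%:C * clog (1 - r%:C * b * z).
have dPsi r : r \in `](- q), q[ -> cderiv Psi r 0.
  move=> rr.
  have nb1 : normc (r%:C * b) < 1.
    move: rr; rewrite in_itv/= -ltr_norml => rr.
    rewrite normcM normcR (le_lt_trans _ bq)// mulrC ler_wpM2l// ltW//.
  (* The derivative is a Schwarz integral, with constant - b and pole parameter r b. *)
  have dPhi : cderiv Phi r ((2 * pi)%:C * (- b * z / (1 - r%:C * b * z))).
    rewrite -circ_herglotz_rational//.
    rewrite (_ : (fun t => _) = (fun t => herglotz_kernel t z *
        (Re (- (b * expi t) / (1 - r%:C * b * expi t)))%:C)); last first.
      by apply/funext => t; rewrite mulrA mulNr.
    rewrite circ_mulr_real /Phi.
    under eq_fun do rewrite circ_mulr_real.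
    by split; [exact: (is_derive_mean_ln ckr bq rr)|exact: (is_derive_mean_ln cki bq rr)].
  have dL := cderiv_clog_sub1 (normcM_lt1 nb1 z1).
  apply: cderiv_eq.
    by apply: cderivD; [exact: dPhi|apply: cderivN; apply: cderivZ; exact: dL].
  by rewrite !mulNr subrr.
have Psi0 : Psi 0 = 0.
  rewrite /Psi /Phi !mul0r subr0 clog1 mulr0 subr0.
  under eq_fun do rewrite !mul0r subr0 normc1 ln1 mulr0.
  by rewrite circ_cst mulr0.
have : Psi 1 = 0.
  rewrite -Psi0; apply: complex_eqP.
  - by apply: (@is_derive0_segment (fun x => Re (Psi x)) _ q1) => x /dPsi [].
  - by apply: (@is_derive0_segment (fun x => Im (Psi x)) _ q1) => x /dPsi [].
by rewrite /Psi /Phi mul1r => /eqP; rewrite subr_eq0 => /eqP <-.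
Qed.

Lemma cont_integrable_co (f : R -> R) : continuous f ->
  mu.-integrable `[0%R, (2 * pi)%R[%classic (EFin \o f).
Proof.
move=> /cont_integrable; apply: integrableS => //.
by apply: subset_itvl; rewrite bnd_simp.
Qed.

(** [herglotz] integrates over the half-open interval, which counts each boundary point once, and
    [circ] over the closed one; for Lebesgue measure the extra endpoint is negligible. *)
Lemma herglotz_lebesgue (k : R -> R) z : continuous k -> normc z < 1 ->
  herglotz mu k z = circ (fun t => herglotz_kernel t z * (k t)%:C).
Proof.
move=> ck z1; rewrite circ_mulr_real /herglotz.
have cr := ccont_Re (ccont_herglotz_kernel z1).
have ci := ccont_Im (ccont_herglotz_kernel z1).
congr (_ +i* _); rewrite -[LHS]/(Rintegral _ _ _); apply: Rintegral_itv_bndo_bndc;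
  by apply: cont_integrable_co => t; apply: cvgM; [exact: cr || exact: ci|exact: ck].
Qed.

(** The logarithm of the boundary modulus of C/(1 - b z)^p. *)
Definition outer_log (C : R) p b (t : R) : R := ln C - p%:R * ln (normc (1 - b * expi t)).

Lemma cont_outer_log C p b : normc b < 1 -> continuous (outer_log C p b).
Proof.
move=> b1 t; apply: cvgB; first exact: cvg_cst.
apply: cvgM; first exact: cvg_cst.
by apply: cont_ln_normc => [|s]; [exact: ccont_sub1|exact: sub1_expi_neq0].
Qed.

Lemma cexp_herglotz_outer_log C p b z : 0 < C -> normc b < 1 -> normc z < 1 ->
  cexp (((2 * pi)^-1)%:C * herglotz mu (outer_log C p b) z) = C%:C / (1 - b * z) ^+ p.
Proof.
move=> C0 b1 z1; rewrite herglotz_lebesgue//; last exact: cont_outer_log.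
have cK := ccont_herglotz_kernel z1.
have cl : ccont (fun t => herglotz_kernel t z * (ln (normc (1 - b * expi t)))%:C).
  apply: ccontM => //; apply: ccont_real; apply: cont_ln_normc; first exact: ccont_sub1.
  by move=> t; exact: sub1_expi_neq0.
rewrite (_ : (fun _ => _) = (fun t => (ln C)%:C * herglotz_kernel t z +
   (- p%:R) * (herglotz_kernel t z * (ln (normc (1 - b * expi t)))%:C))); last first.
  apply/funext => t; rewrite /outer_log rmorphB rmorphM/= rmorph_nat.
  by ring.
have cM (k : R[i]) f : ccont f -> ccont (fun t => k * f t).
  by move=> ?; apply: ccontM => //; exact: ccont_cst.
rewrite circD; [|exact: cM|exact: cM].
rewrite !circZ// circ_herglotz// circ_herglotz_ln//.
rewrite (_ : _ * _ = (ln C)%:C + - (p%:R * clog (1 - b * z))); last first.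
  have : (2 * pi)%:C != 0 :> R[i] by rewrite fmorph_eq0 gt_eqF// twopi_gt0.
  by rewrite fmorphV/=; move: (2 * pi)%:C => P P0; field.
rewrite cexpD cexp_ln// cexpN cexpMn cexp_clog//.
by apply: Re_1B_gt0; exact: normcM_lt1.
Qed.

Lemma is_outer_rational C p b : 0 < C -> normc b < 1 ->
  is_outer (fun z => C%:C / (1 - b * z) ^+ p).
Proof.
move=> C0 b1; exists 1, (outer_log C p b); split; first exact: normc1.
split; first by apply: cont_integrable; exact: cont_outer_log.
by move=> z z1; rewrite cexp_herglotz_outer_log// mul1r.
Qed.

End OuterRepresentation.

(** * Finite Blaschke products *)

Section FiniteBlaschke.
Variable R : realType.
Local Notation mu := (@lebesgue_measure R).
Local Notation I02pi := (`[0%R, (2 * pi)%R]%classic).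
Implicit Types (z b w : R[i]) (zs ws : seq R[i]).

(** All zeros are treated alike here, whereas [blaschke_factor] degenerates to 0 for a zero at the
    origin, its quotient |a|/a being 0 there. *)
Definition mobius b z : R[i] := (z - b) / (1 - b^* * z).
Definition mobs zs z : R[i] := \prod_(b <- zs) mobius b z.

Definition all_disc zs := forall b, b \in zs -> in_disc b.

Lemma in_discE z : in_disc z = (normc z < 1) :> Prop.
Proof. by []. Qed.

Lemma mobius_den_neq0 b z : in_disc b -> normc z <= 1 -> 1 - b^* * z != 0.
Proof.
move=> b1 z1; apply: sub1_neq0; rewrite normcM normcJ.
by apply: le_lt_trans b1; rewrite ler_piMr ?normc_ge0.
Qed.

Lemma mobius_eq0 b z : in_disc b -> normc z <= 1 -> (mobius b z == 0) = (z == b).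
Proof.
move=> b1 z1; rewrite /mobius mulf_eq0 invr_eq0 (negbTE (mobius_den_neq0 b1 z1)) orbF.
by rewrite subr_eq0.
Qed.

Lemma all_disc_cons b zs : all_disc (b :: zs) <-> in_disc b /\ all_disc zs.
Proof.
split=> [h|[hb hz] w]; last by rewrite inE => /predU1P[->|/hz].
by split=> [|w wz]; apply: h; rewrite inE ?eqxx ?wz ?orbT.
Qed.

Lemma mobs_eq0 zs z : all_disc zs -> normc z <= 1 -> (mobs zs z == 0) = (z \in zs).
Proof.
move=> + z1; elim: zs => [|b zs IH]; first by rewrite /mobs big_nil oner_eq0.
by move=> /all_disc_cons[hb hz]; rewrite /mobs big_cons mulf_eq0 inE mobius_eq0// IH.
Qed.

Lemma mobius_expi b t : in_disc b ->
  mobius b (expi t) = expi t * ((1 - b^* * expi t)^* / (1 - b^* * expi t)).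
Proof.
move=> b1; rewrite rmorphB rmorph1 rmorphM/= conjCK expi_conj.
have e0 := expi_neq0 t.
have d0 : 1 - b^* * expi t != 0 by apply: mobius_den_neq0 => //; rewrite normc_expi.
by rewrite /mobius; field; rewrite e0 d0.
Qed.

(** With d = 1 - conj b e^(it), the Moebius factor on the circle is e^(it) (conj d)/d. As d lies in
    the right half-plane, t - 2 arg d is a smooth phase. *)
Definition bphase b (t : R) : R := t - 2 * Im (clog (1 - b^* * expi t)).
Definition bphase' b (t : R) : R :=
  1 - 2 * Im (- (b^* * ('i%C * expi t)) / (1 - b^* * expi t)).

Lemma expi_bphase b t : in_disc b -> expi (bphase b t) = mobius b (expi t).
Proof.
move=> b1; rewrite mobius_expi// expiD; congr (_ * _).
set w := 1 - _.
have w0 : 0 < Re w by apply: Re_1B_gt0; rewrite normcM_expi normcJ.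
have wE : w = (normc w)%:C * expi (Im (clog w)).
  rewrite -{1}(cexp_clog w0) /cexp/= lnK//.
  by rewrite posrE normc_gt0; apply: contraTneq w0 => ->; rewrite ltxx.
have key (n al : R) : n != 0 ->
    expi (- (2 * al)) = (n%:C * expi al)^* / (n%:C * expi al).
  move=> n0; have nc0 : n%:C != 0 :> R[i] by rewrite fmorph_eq0.
  have nJ : (n%:C)^* = n%:C :> R[i] by apply: complex_eqP; rewrite ?ReJ ?ImJ/= ?oppr0.
  rewrite rmorphM/= nJ expiN mulr_natl mulr2n expiD rmorphM/= expi_conj.
  by have := expi_neq0 al => e0; field; rewrite nc0 e0.
rewrite (key (normc w)) -?wE// normc_eq0.
by apply: contraTneq w0 => ->; rewrite ltxx.
Qed.

Lemma is_derive_bphase b (t : R) : in_disc b -> is_derive t 1 (bphase b) (bphase' b t).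
Proof.
move=> b1.
have w0 : 0 < Re (1 - b^* * expi t) by apply: Re_1B_gt0; rewrite normcM_expi normcJ.
have [_ h] := cderiv_clog w0 (cderiv_sub1_expi _ t).
exact: (is_deriveB (is_derive_id t 1) (is_deriveZ 2 h)).
Qed.

Lemma cont_bphase' b : in_disc b -> continuous (bphase' b).
Proof.
move=> b1 t; apply: cvgB; first exact: cvg_cst.
apply: cvgM; first exact: cvg_cst.
apply: (ccont_Im _ (x := t)); apply: ccontM; last by apply: ccont_sub1_inv; rewrite normcJ.
move=> s; apply: ctendsN; apply: ctendsM; first exact: ctends_cst.
by apply: ctendsM; [exact: ctends_cst|exact: ccont_expi].
Qed.

Definition sphase (c : R) zs (t : R) : R := c + \sum_(b <- zs) bphase b t.
Definition sphase' zs (t : R) : R := \sum_(b <- zs) bphase' b t.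

Lemma sphase_cons c b zs : sphase c (b :: zs) = (fun t => bphase b t + sphase c zs t).
Proof. by apply/funext => t; rewrite /sphase big_cons addrCA. Qed.

Lemma expi_sphase c zs t : all_disc zs ->
  expi (sphase c zs t) = expi c * mobs zs (expi t).
Proof.
elim: zs => [|b zs IH]; first by rewrite /sphase /mobs !big_nil addr0 mulr1.
move=> /all_disc_cons[hb hz].
by rewrite sphase_cons expiD expi_bphase// IH// /mobs big_cons mulrCA.
Qed.

Lemma is_derive_sphase c zs (t : R) : all_disc zs ->
  is_derive t 1 (sphase c zs) (sphase' zs t).
Proof.
elim: zs => [|b zs IH].
  move=> _; rewrite (_ : sphase _ _ = cst c); last first.
    by apply/funext => s; rewrite /sphase big_nil addr0.
  by rewrite /sphase' big_nil; exact: is_derive_cst.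
move=> /all_disc_cons[hb hz]; rewrite sphase_cons /sphase' big_cons.
by apply: is_deriveD; [exact: is_derive_bphase|exact: IH].
Qed.

Lemma cont_sphase' zs : all_disc zs -> continuous (sphase' zs).
Proof.
elim: zs => [|b zs IH].
  by move=> _ t; rewrite /sphase'; under eq_fun do rewrite big_nil; exact: cvg_cst.
move=> /all_disc_cons[hb hz] t; rewrite /sphase'; under eq_fun do rewrite big_cons.
apply: cvgD; first exact: cont_bphase'.
exact: IH.
Qed.

(** The logarithmic term of [bphase] depends on e^(it) alone and is periodic, so each zero
    contributes exactly the increment 2 pi of t. This is where the mean-frequency becomes a number
    of zeros. *)
Lemma sphase_period c zs : sphase c zs (2 * pi) - sphase c zs 0 = (2 * pi) * (size zs)%:R.
Proof.
elim: zs => [|b zs IH]; first by rewrite /sphase !big_nil subrr mulr0.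
rewrite sphase_cons opprD addrACA IH (_ : (size (b :: zs))%:R = 1 + (size zs)%:R); last first.
  by rewrite /= -nat1r.
by rewrite /bphase expi0 expi2pi; ring.
Qed.

Lemma integral_sphase' zs : all_disc zs ->
  \int[mu]_(t in I02pi) sphase' zs t = (2 * pi) * (size zs)%:R.
Proof.
move=> hz; rewrite -(sphase_period 0); apply: FTC_circle; first exact: cont_sphase'.
by move=> t; exact: is_derive_sphase.
Qed.

Lemma ctends_mobius (T : Type) (F : set_system T) {FF : Filter F} b (f : T -> R[i]) z :
  in_disc b -> normc z <= 1 -> ctends F f z -> ctends F (fun x => mobius b (f x)) (mobius b z).
Proof.
move=> b1 z1 fz; apply: ctendsM.
  by apply: ctendsB => //; exact: ctends_cst.
apply: ctendsV; first exact: mobius_den_neq0.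
apply: ctendsB; first exact: ctends_cst.
by apply: ctendsM => //; exact: ctends_cst.
Qed.

Lemma ctends_mobs (T : Type) (F : set_system T) {FF : Filter F} zs (f : T -> R[i]) z :
  all_disc zs -> normc z <= 1 -> ctends F f z -> ctends F (fun x => mobs zs (f x)) (mobs zs z).
Proof.
move=> + z1 fz; rewrite /mobs; elim: zs => [|b zs IH].
  by move=> _; under eq_fun do rewrite big_nil; rewrite big_nil; exact: ctends_cst.
move=> /all_disc_cons[hb hz]; under eq_fun do rewrite big_cons.
by rewrite big_cons; apply: ctendsM; [exact: ctends_mobius|exact: IH].
Qed.

Lemma ctends_radius t : ctends (1 : R)^'- (fun r => r%:C * expi t) (expi t).
Proof.
rewrite -[X in ctends _ _ X]mul1r; apply: ctendsM; last exact: ctends_cst.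
by apply: ctends_real; apply: cvg_at_left_filter; exact: cvg_id.
Qed.

Lemma radial_limit_mobs c zs t : all_disc zs ->
  radial_limit (fun z => expi c * mobs zs z) t (expi (sphase c zs t)).
Proof.
move=> hz; rewrite expi_sphase//; apply/ctendsP.
apply: ctendsM; first exact: ctends_cst.
by apply: ctends_mobs => //; [rewrite normc_expi|exact: ctends_radius].
Qed.

Lemma is_phase_mobs c zs : all_disc zs ->
  is_phase (fun z => expi c * mobs zs z) (sphase c zs).
Proof.
move=> hz; split; [|split].
- by apply/aeW => t _; exact: radial_limit_mobs.
- by apply/aeW => t _; case: (is_derive_sphase c t hz).
- rewrite (_ : derive1 _ = sphase' zs); first by apply: cont_integrable; exact: cont_sphase'.
  apply/funext => t; have h := is_derive_sphase c t hz.
  by rewrite derive1E; exact: derive_val.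
Qed.

Lemma mobius_blaschke w z : w != 0 ->
  mobius w z = - (w / (normc w)%:C) * blaschke_factor w z.
Proof.
move=> w0; have n0 : (normc w)%:C != 0 :> R[i] by rewrite fmorph_eq0 normc_eq0.
rewrite /mobius /blaschke_factor mulrA
  (_ : - (w / (normc w)%:C) * ((normc w)%:C / w) = -1); last by field; rewrite w0 n0.
by rewrite mulN1r -[RHS]mulNr opprB.
Qed.

Lemma mobius0 z : mobius 0 z = z.
Proof. by rewrite /mobius rmorph0 mul0r !subr0 divr1. Qed.

Lemma normc_unimod w : w != 0 -> normc (- (w / (normc w)%:C)) = 1.
Proof.
move=> w0; rewrite normcN normcM normcV normcR ger0_norm ?normc_ge0//.
by rewrite divff// normc_eq0.
Qed.

Lemma mobs_perm zs ws z : perm_eq zs ws -> mobs zs z = mobs ws z.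
Proof. by move=> h; rewrite /mobs (perm_big _ h). Qed.

Lemma mobs_cat zs ws z : mobs (zs ++ ws) z = mobs zs z * mobs ws z.
Proof. by rewrite /mobs big_cat. Qed.

Lemma mobs_nseq0 n z : mobs (nseq n 0) z = z ^+ n.
Proof.
by elim: n => [|n IH]; rewrite /mobs ?big_nil//= big_cons mobius0 exprS -/(mobs _ _) IH.
Qed.

Lemma mobs_blaschke_factors ws : (forall w, w \in ws -> w != 0) ->
  exists2 c : R[i], normc c = 1 &
    forall z, mobs ws z = c * \prod_(w <- ws) blaschke_factor w z.
Proof.
elim: ws => [|w ws IH] h.
  by exists 1; [exact: normc1|move=> z; rewrite /mobs !big_nil mulr1].
have w0 : w != 0 by apply: h; rewrite mem_head.
have [c c1 cE] : exists2 c : R[i], normc c = 1 &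
    forall z, mobs ws z = c * \prod_(w <- ws) blaschke_factor w z.
  by apply: IH => v vw; apply: h; rewrite inE vw orbT.
exists (- (w / (normc w)%:C) * c); first by rewrite normcM normc_unimod// c1 mulr1.
move=> z; rewrite /mobs !big_cons -/(mobs _ _) cE mobius_blaschke//.
by rewrite mulrACA.
Qed.

Lemma cvg_eventually_cst (u : nat -> R) N (x : R) : (forall n, (N <= n)%N -> u n = x) ->
  u n @[n --> \oo] --> x.
Proof.
move=> h; rewrite -(cvg_shiftn N); rewrite (_ : (fun n => _) = cst x); first exact: cvg_cst.
by apply/funext => n; rewrite h// leq_addl.
Qed.

Lemma cvg_series_eventually0 (u : nat -> R) N : (forall n, (N <= n)%N -> u n = 0) ->
  cvg (series u @ \oo).
Proof.
move=> h; apply/cvg_ex; exists (series u N); apply: (@cvg_eventually_cst _ N) => n Nn.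
rewrite /series/= (@big_cat_nat _ _ _ N)//= [X in _ + X](_ : _ = 0) ?addr0//.
by rewrite big_nat big1// => i /andP[Ni _]; exact: h.
Qed.

(** Zeros at the origin go into the power of z, the others into a sequence that is eventually
    [None]; the series and the product are then eventually constant. *)
Lemma is_Blaschke_mobs (c : R[i]) zs : normc c = 1 -> all_disc zs ->
  is_Blaschke (fun z => c * mobs zs z).
Proof.
move=> c1 hz.
pose ws := [seq b <- zs | b != 0].
have ws0 w : w \in ws -> w != 0 by rewrite mem_filter => /andP[].
have [d d1 dE] := mobs_blaschke_factors ws0.
have zsE z : mobs zs z = z ^+ (count_mem 0 zs) * mobs ws z.
  rewrite -mobs_nseq0 -mobs_cat; apply: mobs_perm; rewrite perm_sym.
  rewrite (_ : nseq _ _ = [seq b <- zs | b == 0]); last first.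
    elim: zs {hz ws ws0 d d1 dE} => //= b zs IH; case: eqVneq => [->|_] //=.
    by rewrite IH.
  exact: permEl (perm_filterC (pred1 0) zs).
pose a k := nth None [seq Some w | w <- ws] k.
have aN k : (size ws <= k)%N -> a k = None.
  by move=> h; rewrite /a nth_default// size_map.
have aE k w : a k = Some w -> w \in ws.
  have [h|h] := ltnP k (size ws); last by rewrite aN.
  by rewrite /a (nth_map 0)// => -[<-]; exact: mem_nth.
exists (c * d), (count_mem 0 zs), a; split; first by rewrite normcM c1 d1 mulr1.
split.
  move=> k w /aE ww; split; first exact: ws0.
  by apply: hz; move: ww; rewrite mem_filter => /andP[].
split; first by apply: (@cvg_series_eventually0 _ (size ws)) => n /aN ->.
move=> z z1; rewrite /ccvg; apply: (@cvg_eventually_cst _ (size ws)) => n wn.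
rewrite [X in normc (_ * X - _)](_ : _ = \prod_(w <- ws) blaschke_factor w z).
  by rewrite zsE dE (_ : _ - _ = 0) ?normc0//; ring.
rewrite -(big_mkord xpredT (fun k => match a k with Some w => blaschke_factor w z | None => 1 end)).
rewrite (@big_cat_nat _ _ _ (size ws))//= [X in _ * X](_ : _ = 1) ?mulr1; last first.
  by rewrite big_nat big1// => i /andP[wi _]; rewrite aN.
rewrite [RHS](big_nth 0) big_nat [RHS]big_nat; apply: eq_bigr => i /andP[_ iw].
by rewrite /a (nth_map 0).
Qed.

Lemma is_singular_inner_cst (c : R[i]) : normc c = 1 -> is_singular_inner (fun=> c).
Proof.
move=> c1; exists c, (mzero : {measure set (measurableTypeR R) -> \bar R}).
split => //; split => //; split; first by rewrite /mzero ltry.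
split.
  by exists set0; split; [exact: measurable0|split => //; rewrite measure0].
move=> z _; rewrite /herglotz !integral_measure_zero/= (_ : 0 +i* 0 = 0)//.
by rewrite oppr0 cexp0 mulr1.
Qed.

End FiniteBlaschke.

(** * Phases and Hardy space *)

Section PhaseUniqueness.
Variable R : realType.
Local Notation mu := (@lebesgue_measure R).
Local Notation I02pi := (`[0%R, (2 * pi)%R]%classic).

Lemma aeS (P Q : R -> Prop) : (forall x, P x -> Q x) ->
  {ae mu, forall x, P x} -> {ae mu, forall x, Q x}.
Proof. by move=> PQ; apply: filterS => //; exact: (ae_filter_ringOfSetsType mu). Qed.

Lemma aeI (P Q : R -> Prop) : {ae mu, forall x, P x} -> {ae mu, forall x, Q x} ->
  {ae mu, forall x, P x /\ Q x}.
Proof. by move=> aP aQ; apply: filterI => //; exact: (ae_filter_ringOfSetsType mu). Qed.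

Lemma ae_neq (x : R) : {ae mu, forall s : R, s != x}.
Proof.
exists [set x]; split => //; first exact: lebesgue_measure_set1.
by move=> s /= /negP; rewrite negbK => /eqP.
Qed.

Lemma ae_interval_nonempty (P : R -> Prop) (x y : R) : x < y ->
  {ae mu, forall t, P t} -> exists2 t, x < t < y & P t.
Proof.
move=> xy [N [mN N0 NP]]; apply: contrapT => h.
have sub : `]x, y[%classic `<=` N.
  move=> t /=; rewrite in_itv/= => txy; apply: NP => /= Pt.
  by apply: h; exists t.
have := le_measure mu (mem_set (measurable_itv `]x, y[)) (mem_set mN) sub.
by rewrite [X in (_ <= X)%E](_ : _ = 0%E)//= lebesgue_measure_itv/= lte_fin xy -EFinB lee_fin leNgt subr_gt0 xy.
Qed.

(** The difference d = th - Th lies in 2 pi Z at t and at almost every s. If its derivative D at t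
    were nonzero, d s would differ from d t for all s != t near t. But d is continuous at t, so |d t
    - d s| < pi nearby, and two such elements of 2 pi Z coincide. No continuity of [th] away from t
    is assumed. *)
Lemma derive_lift_unique (th Th : R -> R) (dTh t : R) :
  {ae mu, forall s, 0 < s < 2 * pi -> expi (th s) = expi (Th s)} ->
  0 < t < 2 * pi -> expi (th t) = expi (Th t) ->
  derivable th t 1 -> is_derive t 1 Th dTh -> derive1 th t = dTh.
Proof.
move=> aeE t02 Et dth dTh'.
have idth : is_derive t 1 th (derive1 th t).
  by apply: DeriveDef => //; rewrite derive1E.
pose d x := th x - Th x; set D := derive1 th t - dTh.
have dd : is_derive t 1 d D := is_deriveB idth dTh'.
apply/eqP; rewrite -subr_eq0; apply/negPn/negP; rewrite -/D => D0.
have cd : d x @[x --> t] --> d t.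
  by apply: differentiable_continuous; apply/derivable1_diffP; case: dd.
have qd : h^-1 *: (d (h *: 1 + t) - d t) @[h --> 0^'] --> D.
  by case: dd => dd1 <-; exact: dd1.
(* With tolerance |D|, the difference quotient cannot vanish for small nonzero h. *)
have e1 : \forall h \near (0 : R)^', `|D - h^-1 *: (d (h *: 1 + t) - d t)| < `|D|.
  by move/cvgrPdist_lt : qd; apply; rewrite normr_gt0.
have e2 : \forall s \near t, `|d t - d s| < pi.
  by move/cvgrPdist_lt : cd; apply; exact: pi_gt0.
have e3 : \forall s \near t, 0 < s < 2 * pi.
  by have /near_in_itvoo : t \in `]0, (2 * pi)[ by [].
move: e1; rewrite near_withinE => -[r1 /= r10 e1].
move: e2 => [r2 /= r20 e2]; move: e3 => [r3 /= r30 e3].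
pose r := Num.min r1 (Num.min r2 r3).
have r0 : 0 < r by rewrite !lt_min r10 r20 r30.
(* A set of full measure meets every interval to the right of t. *)
have [s ts Es] := ae_interval_nonempty (ltr_pwDr r0 (lexx t)) aeE.
have st0 : s - t != 0 by rewrite subr_eq0; case/andP: ts => /gt_eqF ->.
have sr : `|s - t| < r by case/andP: ts => ? ?; rewrite ger0_norm; lra.
move: sr; rewrite !lt_min => /and3P[sr1 sr2 sr3].
have s02 : 0 < s < 2 * pi by apply: e3; rewrite /= distrC.
have ds : `|d t - d s| < pi by apply: e2; rewrite /= distrC.
have expid x : expi (th x) = expi (Th x) -> expi (d x) = 1.
  move=> h; have -> : d x = th x + - Th x by [].
  by rewrite expiD expiN h mulcJ normc_expi expr1n.
have dts : d t = d s.
  by apply: expi_inj_small => //; rewrite !expid//; exact: Es.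
have := e1 (s - t); rewrite /= sub0r normrN {2}/GRing.scale/= mulr1 subrK => /(_ sr1 st0).
by rewrite dts subrr scaler0 subr0 ltxx.
Qed.

Lemma radial_limit_unique (g : R[i] -> R[i]) t v w :
  radial_limit g t v -> radial_limit g t w -> v = w.
Proof. by move=> /ctendsP gv /ctendsP gw; exact: ctends_unique gv gw. Qed.

Lemma phase_integral_unique (g : R[i] -> R[i]) (th Th Th' : R -> R) :
  continuous Th' -> (forall t : R, is_derive t 1 Th (Th' t)) ->
  (forall t, radial_limit g t (expi (Th t))) -> is_phase g th ->
  \int[mu]_(t in I02pi) derive1 th t = \int[mu]_(t in I02pi) Th' t.
Proof.
move=> cTh' dTh gTh [gth [dth ith]].
have aeE : {ae mu, forall s, 0 < s < 2 * pi -> expi (th s) = expi (Th s)}.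
  by move: gth; apply: aeS => s gs /gs h; exact: radial_limit_unique h (gTh s).
rewrite /Rintegral; congr fine; apply: ae_eq_integral => //.
- exact: (measurable_int mu ith).
- exact: (measurable_int mu (cont_integrable cTh')).
- have h := aeI aeE (aeI dth (aeI (ae_neq 0) (ae_neq (2 * pi)))).
  move: h; apply: aeS => t [Et [Dt [t0 t2]]] /=; rewrite in_itv/= => /andP[t0' t2'].
  have t02 : 0 < t < 2 * pi by rewrite !lt_neqAle eq_sym t0 t0' t2 t2'.
  congr EFin; apply: (derive_lift_unique aeE) => //; first exact: Et.
  exact: Dt.
Qed.

End PhaseUniqueness.

(** * Membership in the Hardy space and positivity of the norm *)

Section HardySpace.
Variable R : realType.
Local Notation mu := (@lebesgue_measure R).
Local Notation I02pi := (`[0%R, (2 * pi)%R]%classic).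
Implicit Types (f : R[i] -> R[i]) (b z : R[i]).

(** A condition stronger than square summability, chosen because it is inherited under
    multiplication by z - b and division by 1 - b z; an induction on the factors then covers all the
    rational functions needed. The rate q may change from step to step. *)
Definition geometric_coefs f := exists (c : nat -> R[i]) (M q : R),
  [/\ 0 < q < 1, forall k, normc (c k) <= M * q ^+ k &
      forall z, in_disc z -> ctends \oo (fun N => \sum_(k < N) c k * z ^+ k) (f z)].

Lemma geometric_coefs_H2 f : geometric_coefs f -> in_H2 f.
Proof.
move=> [c [M [q [/andP[q0 q1] cM cf]]]]; exists c; split; last first.
  by move=> z z1; apply/ctendsP; exact: cf.
apply: (@series_le_cvg _ _ (geometric (M ^+ 2) (q ^+ 2))).
- by move=> n; exact: sqr_ge0.
- move=> n; rewrite /geometric/=; apply: mulr_ge0; first exact: sqr_ge0.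
  by rewrite exprn_ge0// sqr_ge0.
- move=> n; rewrite /geometric/= -exprM mulnC exprM -exprMn.
  by rewrite lerXn2r ?nnegrE ?normc_ge0// (le_trans (normc_ge0 _) (cM n)).
- by apply: is_cvg_geometric_series; rewrite ger0_norm ?sqr_ge0// expr_lt1// ltW.
Qed.

Lemma geometric_coefs_cst (w : R[i]) : geometric_coefs (fun=> w).
Proof.
exists (fun k => if k is 0%N then w else 0), (normc w), 2^-1; split.
- by apply/andP; split; lra.
- case=> [|k]; first by rewrite expr0 mulr1.
  by rewrite normc0 mulr_ge0 ?normc_ge0// exprn_ge0.
- move=> z z1; apply/ctendsP; apply: (@cvg_eventually_cst _ _ 1) => -[//|n] _.
  rewrite big_ord_recl/= expr0 mulr1 big1 ?addr0 ?subrr ?normc0// => i _.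
  by rewrite mul0r.
Qed.

Lemma ctends_geometric_term (c : nat -> R[i]) (M q : R) z : 0 < q < 1 ->
  (forall k, normc (c k) <= M * q ^+ k) -> normc z <= 1 ->
  ctends \oo (fun k => c k * z ^+ k) 0.
Proof.
move=> /andP[q0 q1] cM z1; apply/ctendsP.
have h : M * q ^+ k @[k --> \oo] --> (0 : R).
  rewrite -[X in _ --> X](mulr0 M); apply: cvgM; first exact: cvg_cst.
  by apply: cvg_expr; rewrite ger0_norm// ltW.
apply: (cvg0_le_norm h) => k; rewrite subr0 ger0_norm ?normc_ge0// normcM normcX.
apply: le_trans (cM k); rewrite ler_piMr ?normc_ge0// exprn_ile1 ?normc_ge0//.
Qed.

Lemma geometric_coefs_sub f b : geometric_coefs f ->
  geometric_coefs (fun z => (z - b) * f z).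
Proof.
move=> [c [M [q [q01 cM cf]]]].
have /andP[q0 q1] := q01.
pose p k := if k is k'.+1 then c k' else 0.
have M0 : 0 <= M by have := cM 0%N; rewrite expr0 mulr1; exact: le_trans (normc_ge0 _).
have pM k : normc (p k) <= (M / q) * q ^+ k.
  case: k => [|k]; first by rewrite normc0 expr0 mulr1 divr_ge0// ltW.
  by rewrite /= exprS mulrA divfK ?gt_eqF.
exists (fun k => p k - b * c k), (M / q + normc b * M), q; split => //.
  move=> k; apply: (le_trans (le_normcB _ _)); rewrite mulrDl lerD// normcM -mulrA.
  by rewrite ler_wpM2l ?normc_ge0.
move=> z z1.
(* The partial sums of the product agree with z - b times those of f up to one boundary term, which
   tends to 0. *)
have GE N : \sum_(k < N) (p k - b * c k) * z ^+ k =
    (z - b) * (\sum_(k < N) c k * z ^+ k) - p N * z ^+ N.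
  elim: N => [|N IH]; first by rewrite !big_ord0 mulr0 mul0r subr0.
  by rewrite !big_ord_recr/= IH exprS; ring.
under eq_fun do rewrite GE.
rewrite -[X in ctends _ _ X]subr0; apply: ctendsB.
  by apply: ctendsM; [exact: ctends_cst|exact: cf].
exact: (ctends_geometric_term q01 pM (ltW z1)).
Qed.

Lemma geometric_coefs_div f b : in_disc b -> geometric_coefs f ->
  geometric_coefs (fun z => f z / (1 - b * z)).
Proof.
rewrite in_discE => b1 [c [M [q [/andP[q0 q1] cM cf]]]].
have nb0 := normc_ge0 b.
have M0 : 0 <= M by have := cM 0%N; rewrite expr0 mulr1; exact: le_trans (normc_ge0 _).
(* A common rate for f and for the powers of b, strictly above |b| so that [L] below is finite. *)
pose r := Num.max q ((1 + normc b) / 2).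
have r01 : 0 < r < 1 by rewrite /r lt_max gt_max q0 q1/=; lra.
have br : normc b < r by rewrite /r lt_max; apply/orP; right; lra.
have /andP[r0 r1] := r01.
have cM' k : normc (c k) <= M * r ^+ k.
  apply: (le_trans (cM k)); rewrite ler_wpM2l// lerXn2r ?nnegrE ?(ltW q0) ?(ltW r0)//.
  by rewrite /r le_max lexx.
(* The sums d k = c k + e k satisfy d (k+1) = c (k+1) + b d k, the recurrence for the coefficients
   of f/(1 - b z). *)
pose e := fix e k := if k is k'.+1 then b * (c k' + e k') else 0.
(* The solution of |b| (M + L) = r L, which makes the induction for [eL] close. *)
pose L := normc b * M / (r - normc b).
have rb : 0 < r - normc b by rewrite subr_gt0.
have L0 : 0 <= L by rewrite /L divr_ge0 ?mulr_ge0// ltW.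
have eL k : normc (e k) <= L * r ^+ k.
  elim: k => [|k IH]; first by rewrite normc0 mulr_ge0// exprn_ge0// ltW.
  rewrite /= normcM exprS (mulrCA L).
  apply: (@le_trans _ _ (normc b * ((M + L) * r ^+ k))).
    by rewrite ler_wpM2l// (le_trans (le_normcD _ _))// mulrDl lerD.
  rewrite mulrA mulrA ler_wpM2r ?exprn_ge0 ?(ltW r0)//.
  rewrite (_ : normc b * (M + L) = r * L)// /L; field.
  by rewrite gt_eqF.
exists (fun k => c k + e k), (M + L), r; split => //.
  by move=> k; apply: (le_trans (le_normcD _ _)); rewrite mulrDl lerD.
move=> z z1.
have d0 : 1 - b * z != 0 by apply: sub1_neq0; exact: normcM_lt1.
have DE N : \sum_(k < N) (c k + e k) * z ^+ k =
    (\sum_(k < N) c k * z ^+ k - e N * z ^+ N) / (1 - b * z).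
  apply: (mulIf d0); rewrite divfK//.
  elim: N => [|N IH]; first by rewrite !big_ord0 !mul0r subr0.
  by rewrite !big_ord_recr/= mulrDl IH exprS; ring.
under eq_fun do rewrite DE.
apply: ctendsM; last exact: ctends_cst.
rewrite -[X in ctends _ _ X]subr0; apply: ctendsB; first exact: cf.
exact: (ctends_geometric_term r01 eL (ltW z1)).
Qed.

(** The bound B serves to make the supremum genuine, since [sup] of an unbounded set is a default
    value; one circle on which |f| >= m then bounds it from below. *)
Lemma H2_norm_gt0 f (B m r0 : R) :
  (forall r, 0 <= r < 1 -> ccont (fun t => f (r%:C * expi t))) ->
  (forall z, in_disc z -> normc (f z) <= B) ->
  0 <= r0 < 1 -> 0 < m -> (forall t, m <= normc (f (r0%:C * expi t))) ->
  0 < H2_norm f.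
Proof.
move=> cf fB r01 m0 fm; rewrite sqrtr_gt0.
have cn r : 0 <= r < 1 -> continuous (fun t => normc (f (r%:C * expi t)) ^+ 2).
  move=> r1 t; have h : normc (f (r%:C * expi x)) @[x --> t] --> normc (f (r%:C * expi t)).
    by apply: ctends_norm; exact: cf.
  exact: (cvgM h h).
have ic (x : R) : mu.-integrable I02pi (EFin \o cst x).
  by apply: cont_integrable => t; exact: cvg_cst.
have mean (x : R) : (2 * pi)^-1 * \int[mu]_(t in I02pi) cst x t = x.
  by rewrite Rintegral_cst//= lebesgue_I02pi/= mulrCA mulVf ?mulr1// gt_eqF// twopi_gt0.
have ip : 0 <= (2 * pi)^-1 :> R by rewrite invr_ge0 ltW// twopi_gt0.
set S := (X in sup X).
have ubS : ubound S (B ^+ 2).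
  move=> _ [r /= r1 <-]; move: r1; rewrite in_itv/= => r1.
  rewrite -[leRHS]mean ler_wpM2l//; apply: le_Rintegral => //.
    by apply: cont_integrable; exact: cn.
  have /andP[r0' r1'] := r1.
  move=> t _; rewrite /cst lerXn2r ?nnegrE ?normc_ge0//; last first.
    by apply: fB; rewrite in_discE normcM_expi normcR ger0_norm.
  by apply: (le_trans (normc_ge0 (f 0))); apply: fB; rewrite in_discE normc0.
have Sr0 : S ((2 * pi)^-1 * \int[mu]_(t in I02pi) (normc (f (r0%:C * expi t)) ^+ 2)).
  by exists r0 => //=; rewrite in_itv.
apply: lt_le_trans (ub_le_sup _ Sr0); last by exists (B ^+ 2).
apply: (@lt_le_trans _ _ (m ^+ 2)); first exact: exprn_gt0.
rewrite -[leLHS]mean ler_wpM2l//; apply: le_Rintegral => //.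
  by apply: cont_integrable; exact: cn.
by move=> t _; rewrite /cst lerXn2r ?nnegrE ?normc_ge0 ?(ltW m0).
Qed.

Lemma szego_H2_norm_gt0 n (a : R[i]) : in_disc a -> 0 < H2_norm (szego_kernel n a).
Proof.
move=> a1; have na0 := normc_ge0 a.
have a1' : 0 < 1 - normc a by rewrite subr_gt0.
have nE z : normc (szego_kernel n a z) =
    n`!%:R * normc z ^+ n / normc (1 - a^* * z) ^+ n.+1.
  by rewrite /szego_kernel !normcM normcV !normcX normc_nat.
(* In the disc |z| < 1 and |1 - conj a z| >= 1 - |a|; on the circle of radius 1/2, |1 - conj a z| <=
   2. The radius 0 would fail for n >= 1, where the kernel vanishes at the centre. *)
apply: (@H2_norm_gt0 _ (n`!%:R / (1 - normc a) ^+ n.+1)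
  (n`!%:R * 2^-1 ^+ n / 2 ^+ n.+1) 2^-1).
- move=> r /andP[r0 r1]; apply: ccontM.
    apply: ccontM; first exact: ccont_cst.
    move=> t; apply: ctendsX; apply: ctendsM; first exact: ctends_cst.
    exact: ccont_expi.
  apply: ccontV => [t|].
    rewrite expf_neq0//; apply: mobius_den_neq0 => //.
    by rewrite normcM_expi normcR ger0_norm// ltW.
  move=> t; apply: ctendsX; apply: ctendsB; first exact: ctends_cst.
  apply: ctendsM; first exact: ctends_cst.
  by apply: ctendsM; [exact: ctends_cst|exact: ccont_expi].
- move=> z z1; rewrite nE ler_pM ?mulr_ge0 ?exprn_ge0 ?normc_ge0 ?invr_ge0//.
    by rewrite exprn_ge0 ?normc_ge0.
    by rewrite ler_piMr// exprn_ile1 ?normc_ge0// ltW.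
  rewrite lef_pV2 ?posrE ?exprn_gt0//; last first.
    by rewrite normc_gt0; apply: mobius_den_neq0 => //; exact: ltW.
  rewrite lerXn2r ?nnegrE ?normc_ge0 ?(ltW a1')//.
  apply: le_trans (le_normc_dist _ _); rewrite normc1 lerD2l lerN2 normcM normcJ.
  by rewrite ler_piMr// ltW.
- by apply/andP; split; lra.
- by rewrite divr_gt0 ?mulr_gt0 ?exprn_gt0// ?ltr0n ?fact_gt0.
- move=> t; rewrite nE normcM_expi normcR ger0_norm//.
  rewrite ler_wpM2l ?mulr_ge0 ?exprn_ge0// lef_pV2 ?posrE ?exprn_gt0//; last first.
    rewrite normc_gt0; apply: mobius_den_neq0 => //.
    by rewrite normcM_expi normcR ger0_norm//; lra.
  rewrite lerXn2r ?nnegrE ?normc_ge0//.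
  apply: (le_trans (le_normcB _ _)).
  rewrite normc1 normcM normcJ normcM_expi normcR ger0_norm//.
  have : normc a * 2^-1 <= 1 by move: a1; rewrite in_discE; lra.
  lra.
Qed.

End HardySpace.

(** * Zeros of a factorization *)

Section HerglotzBounds.
Variable R : realType.
Implicit Types (z : R[i]) (nu : {measure set (measurableTypeR R) -> \bar R}).
Local Notation J02pi := (`[0%R, (2 * pi)%R[%classic : set (measurableTypeR R)).

Lemma cont_measurable (f : R -> R) (D : set (measurableTypeR R)) :
  continuous f -> measurable_fun D f.
Proof.
move=> cf; apply: measurable_funTS; exact: continuous_measurable_fun.
Qed.

Lemma normc_herglotz_kernel (t : R) z : in_disc z ->
  normc (herglotz_kernel t z) <= 2 / (1 - normc z).
Proof.
rewrite in_discE => z1; rewrite /herglotz_kernel normcM normcV; apply: ler_pM.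
- exact: normc_ge0.
- by rewrite invr_ge0 normc_ge0.
- by apply: (le_trans (le_normcD _ _)); rewrite normc_expi; lra.
- rewrite lef_pV2 ?posrE ?normc_gt0 ?expi_sub_neq0 ?subr_gt0//.
  by apply: le_trans (le_normc_dist _ _); rewrite normc_expi.
Qed.

Lemma integrable_bounded_mul nu (g k : R -> R) (M : R) : continuous g ->
  (forall t, `|g t| <= M) -> nu.-integrable J02pi (EFin \o k) ->
  nu.-integrable J02pi (EFin \o (fun t => g t * k t)).
Proof.
move=> cg gM ik; have mJ : measurable J02pi by [].
have h : nu.-integrable J02pi ((EFin \o g) \* (EFin \o k))%E.
  apply: integrableMr => //; first exact: cont_measurable.
  exists M; split; first exact: num_real.
  by move=> x Mx t _ /=; apply: (le_trans (gM t)); exact: ltW.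
by apply: eq_integrable h => // t _.
Qed.

Lemma integrable_Re_herglotz nu (k : R -> R) z : in_disc z ->
  nu.-integrable J02pi (EFin \o k) ->
  nu.-integrable J02pi (EFin \o (fun t => Re (herglotz_kernel t z) * k t)).
Proof.
move=> z1 ik; apply: (@integrable_bounded_mul _ _ _ (2 / (1 - normc z))) => //.
  by apply: ccont_Re; exact: ccont_herglotz_kernel.
by move=> t; apply: (le_trans (le_Re_normc _)); exact: normc_herglotz_kernel.
Qed.

Lemma Re_herglotz nu (k : R -> R) z :
  Re (herglotz nu k z) = \int[nu]_(t in J02pi) (Re (herglotz_kernel t z) * k t).
Proof. by []. Qed.

Lemma Re_herglotz_bound nu (k : R -> R) z : in_disc z ->
  nu.-integrable J02pi (EFin \o k) ->
  `|Re (herglotz nu k z)| <= 2 / (1 - normc z) * \int[nu]_(t in J02pi) `|k t|.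
Proof.
move=> z1 ik; rewrite Re_herglotz.
have mJ : measurable J02pi by [].
have ik' : nu.-integrable J02pi (EFin \o (fun t => `|k t|)) by exact: integrable_norm.
have iK := integrable_Re_herglotz z1 ik.
apply: (le_trans (le_normr_Rintegral mJ iK)).
rewrite -RintegralZl//; apply: le_Rintegral => //.
- exact: integrable_norm.
- have := integrableZl mJ (2 / (1 - normc z)) ik'.
  by apply: eq_integrable.
- move=> t _; rewrite normrM ler_wpM2r//.
  by apply: (le_trans (le_Re_normc _)); exact: normc_herglotz_kernel.
Qed.

Lemma integrable_cst1 nu : (nu J02pi < +oo)%E -> nu.-integrable J02pi (EFin \o (fun=> 1 : R)).
Proof.
move=> h; have mJ : measurable J02pi by [].
apply: measurable_bounded_integrable => //.
exists 1; split; first exact: num_real.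
by move=> x x1 t _ /=; rewrite normr1 ltW.
Qed.

Lemma is_singular_innerP (s : R[i] -> R[i]) : is_singular_inner s ->
  exists (c : R[i]) nu, [/\ normc c = 1, nu.-integrable J02pi (EFin \o (fun=> 1)),
    nu (~` J02pi) = 0%E, (nu J02pi < +oo)%E &
    forall z, in_disc z -> s z = c * cexp (- herglotz nu (fun=> 1) z)].
Proof.
move=> [c [nu [c1 [nuC [nufin [_ sE]]]]]]; exists c, nu; split => //.
exact: integrable_cst1.
Qed.

Lemma is_outerP (o : R[i] -> R[i]) : is_outer o ->
  exists (c : R[i]) (k : R -> R), [/\ normc c = 1,
    (@lebesgue_measure R).-integrable J02pi (EFin \o k) &
    forall z, in_disc z -> o z = c * cexp (((2 * pi)^-1)%:C * herglotz lebesgue_measure k z)].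
Proof.
move=> [c [k [c1 [ik oE]]]]; exists c, k; split => //.
by move: ik; apply: integrableS => //; apply: subset_itvl; rewrite bnd_simp.
Qed.

(** The logarithm of |o| is a Herglotz integral whose kernel is at most 2/(1 - r) in modulus. The
    singular factor is bounded in the same way, with its measure in place of the density. *)
Lemma outer_bound (o : R[i] -> R[i]) (r : R) : is_outer o -> r < 1 ->
  exists2 M, 0 < M & forall z, normc z <= r -> M^-1 <= normc (o z) <= M.
Proof.
move=> /is_outerP[c [k [c1 ik oE]]] r1.
pose L := (2 * pi)^-1 * (2 / (1 - r) * \int[lebesgue_measure]_(t in J02pi) `|k t|).
exists (expR L); first exact: expR_gt0.
move=> z zr; have z1 : in_disc z by rewrite in_discE (le_lt_trans zr).
rewrite oE// normcM c1 mul1r normc_cexp -expRN !ler_expR -ler_norml.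
have ip : 0 <= (2 * pi)^-1 :> R by rewrite invr_ge0 ltW// twopi_gt0.
rewrite ReM [Re _%:C]/= [Im _%:C]/= mul0r subr0 normrM ger0_norm// ler_wpM2l//.
apply: (le_trans (Re_herglotz_bound z1 ik)); rewrite ler_wpM2r//.
  by apply: Rintegral_ge0 => t _.
by rewrite ler_wpM2l// lef_pV2 ?posrE ?subr_gt0// lerD2l lerN2.
Qed.

Lemma singular_inner_bound (s : R[i] -> R[i]) (r : R) : is_singular_inner s -> r < 1 ->
  exists2 M, 0 < M & forall z, normc z <= r -> M^-1 <= normc (s z) <= M.
Proof.
move=> /is_singular_innerP[c [nu [c1 ik _ _ sE]]] r1.
pose L := 2 / (1 - r) * \int[nu]_(t in J02pi) `|1 : R|.
exists (expR L); first exact: expR_gt0.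
move=> z zr; have z1 : in_disc z by rewrite in_discE (le_lt_trans zr).
rewrite sE// normcM c1 mul1r normc_cexp -expRN !ler_expR -ler_norml ReN normrN.
apply: (le_trans (Re_herglotz_bound z1 ik)); rewrite ler_wpM2r//.
  by apply: Rintegral_ge0 => t _.
by rewrite ler_wpM2l// lef_pV2 ?posrE ?subr_gt0// lerD2l lerN2.
Qed.

End HerglotzBounds.

(** * Zeros with multiplicity *)

Section ZeroUniqueness.
Variable R : realType.
Implicit Types (z w b : R[i]) (zs ws : seq R[i]) (phi : R[i] -> R[i]).

Lemma blaschke_factor_eq0 w : blaschke_factor w w = 0.
Proof. by rewrite /blaschke_factor subrr mul0r mulr0. Qed.

Lemma all_disc_gap zs : all_disc zs ->
  exists2 d : R, 0 < d & forall w, w \in zs -> d <= 1 - normc w.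
Proof.
elim: zs => [|w zs IH]; first by exists 1.
move=> /all_disc_cons[w1 /IH[d d0 dz]]; exists (Num.min d (1 - normc w)).
  by rewrite lt_min d0 subr_gt0.
by move=> v; rewrite inE => /predU1P[->|/dz vd]; rewrite ge_min ?lexx ?orbT// vd.
Qed.

Lemma prod_pmap (a : nat -> option R[i]) (F : R[i] -> R[i]) (s : seq nat) :
  \prod_(k <- s) (match a k with Some w => F w | None => 1 end) =
  \prod_(w <- pmap a s) F w.
Proof.
elim: s => [|k s IH]; first by rewrite !big_nil.
by rewrite big_cons /=; case: (a k) => [w|]; rewrite /= ?big_cons IH// mul1r.
Qed.

(* A zero repeated infinitely often would contradict the Blaschke condition. *)
Lemma blaschke_finite phi zs : is_Blaschke phi -> all_disc zs ->
  (forall z, in_disc z -> phi z = 0 -> z \in zs) ->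
  exists (c : R[i]) ws, [/\ normc c = 1, all_disc ws &
    forall z, in_disc z -> phi z = c * mobs ws z].
Proof.
move=> [c [m [a [c1 [aP [asum phiE]]]]]] hz phi0.
(* From index k + 1 on, the partial products contain the factor vanishing at w, so phi w = 0. *)
have azs k w : a k = Some w -> w \in zs.
  move=> akw; have [w0 w1] := aP _ _ akw.
  apply: phi0 => //; have /ctendsP h := phiE w w1.
  apply: (ctends_unique h); apply/ctendsP; apply: (@cvg_eventually_cst _ _ k.+1) => n kn.
  rewrite (bigD1 (Ordinal kn))//= akw blaschke_factor_eq0 mul0r mulr0 subrr.
  exact: normc0.
have [d d0 dz] := all_disc_gap hz.
have := cvg_series_cvg_0 asum => /cvgrPdist_lt/(_ _ d0)[K _ aK].
have aN k : (K <= k)%N -> a k = None.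
  move=> Kk; case E : (a k) => [w|//]; have := aK k Kk; rewrite /= E sub0r normrN.
  have dw := dz _ (azs _ _ E).
  by rewrite ger0_norm ?(le_trans (ltW d0))// ltNge dw.
pose ws := pmap a (iota 0 K).
have wsP w : w \in ws -> w != 0 /\ in_disc w.
  by rewrite mem_pmap => /mapP[k _ /esym]; exact: aP.
have [e e1 eE] := @mobs_blaschke_factors R ws (fun w ww => (wsP w ww).1).
have e0 : e != 0 by rewrite -normc_gt0 e1.
exists (c / e), (nseq m 0 ++ ws); split.
- by rewrite normcM normcV c1 e1 divr1.
- move=> b; rewrite mem_cat => /orP[|/wsP[]//].
  by rewrite mem_nseq => /andP[_ /eqP ->]; rewrite in_discE normc0.
move=> z z1; have /ctendsP h := phiE z z1; apply: (ctends_unique h).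
apply/ctendsP; apply: (@cvg_eventually_cst _ _ K) => n Kn.
rewrite mobs_cat mobs_nseq0 eE -prod_pmap.
rewrite -(big_mkord xpredT (fun k => match a k with Some w => blaschke_factor w z | None => 1 end)).
rewrite (@big_cat_nat _ _ _ K)//= [X in _ * (_ * X)](_ : _ = 1) ?mulr1; last first.
  by rewrite big_nat big1// => i /andP[Ki _]; rewrite aN.
rewrite /index_iota subn0 (_ : _ - _ = 0) ?normc0//.
by field.
Qed.

(** A way to compare orders of zeros by moduli alone: it forces [ws] to be contained in [zs] with
    multiplicity. *)
Definition dominated zs ws := forall r : R, r < 1 -> exists M : R, forall z,
  normc z <= r -> normc (mobs zs z) <= M * normc (mobs ws z).

(** The common factor cancels wherever it is nonzero, that is, off w; the inequality at w itself is
    the limit of the inequalities at w + x as x decreases to 0. *)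
Lemma dominated_rem zs ws w : all_disc (w :: zs) -> all_disc (w :: ws) ->
  dominated (w :: zs) (w :: ws) -> dominated zs ws.
Proof.
move=> /all_disc_cons[w1 hz] /all_disc_cons[_ hw] dom r r1.
(* The larger disc contains w in its interior, leaving room for the points w + x. *)
pose r' := Num.max r ((1 + normc w) / 2).
have r'1 : r' < 1 by rewrite gt_max r1; move: w1; rewrite in_discE; lra.
have wr' : normc w < r' by rewrite lt_max; apply/orP; right; move: w1; rewrite in_discE; lra.
have [M MP] := dom r' r'1; exists M.
have off z : normc z <= r' -> z != w -> normc (mobs zs z) <= M * normc (mobs ws z).
  move=> zr zw; have := MP z zr; rewrite /mobs !big_cons ![normc (mobius w z * _)]normcM mulrCA ler_pM2l//.
  rewrite normc_gt0 mobius_eq0//.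
  by rewrite (le_trans zr)// ltW.
move=> z zr; have zr' : normc z <= r' by rewrite (le_trans zr)// le_max lexx.
have [->|zw] := eqVneq z w; last exact: off.
have tw : ctends (0 : R)^'+ (fun x : R => w + x%:C) w.
  rewrite -[X in ctends _ _ X]addr0; apply: ctendsD; first exact: ctends_cst.
  by apply: ctends_real; apply: cvg_at_right_filter; exact: cvg_id.
have l1 : normc (mobs zs (w + x%:C)) @[x --> (0 : R)^'+] --> normc (mobs zs w).
  by apply: ctends_norm; apply: ctends_mobs => //; exact: ltW.
have l2 : M * normc (mobs ws (w + x%:C)) @[x --> (0 : R)^'+] --> M * normc (mobs ws w).
  apply: cvgM; first exact: cvg_cst.
  by apply: ctends_norm; apply: ctends_mobs => //; exact: ltW.
apply: (ler_cvg_to l1 l2).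
near=> x.
  have x0 : 0 < x by near: x; exact: nbhs_right_gt.
  have xr : x < r' - normc w by near: x; apply: nbhs_right_lt; rewrite subr_gt0.
  apply: off.
    by apply: (le_trans (le_normcD _ _)); rewrite normcR gtr0_norm//; lra.
  by rewrite -subr_eq0 addrAC subrr add0r fmorph_eq0 gt_eqF.
Unshelve. all: by end_near. Qed.

Lemma dominated_perm zs zs' ws : perm_eq zs zs' -> dominated zs ws -> dominated zs' ws.
Proof.
by move=> p dom r /dom[M MP]; exists M => z /MP; rewrite (mobs_perm _ p).
Qed.

(** The head w of [ws] is a zero of [mobs ws], hence of [mobs zs] by domination, so it occurs in
    [zs] and can be removed from both lists. *)
Lemma dominated_size zs ws : all_disc zs -> all_disc ws -> dominated zs ws ->
  exists rest, perm_eq zs (ws ++ rest).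
Proof.
elim: ws zs => [|w ws IH] zs hz hw dom; first by exists zs.
have /all_disc_cons[w1 hw'] := hw.
have wz : w \in zs.
  rewrite -(mobs_eq0 hz (ltW w1)) -normc_eq0 eq_le normc_ge0 andbT.
  have [M /(_ w (lexx _))] := dom _ w1.
  by rewrite (_ : mobs (w :: ws) w = 0) ?normc0 ?mulr0//; apply/eqP; rewrite mobs_eq0 ?mem_head// ltW.
have p := perm_to_rem wz.
have hz' : all_disc (w :: rem w zs) by move=> b bz; apply: hz; rewrite (perm_mem p).
have [_ hz''] := (all_disc_cons _ _).1 hz'.
have [rest pr] := IH _ hz'' hw' (dominated_rem hz' hw (dominated_perm p dom)).
exists rest; apply: (perm_trans p); by rewrite /= perm_cons.
Qed.

(** On each disc of radius r < 1, the factors s and o and the power of 1 - b z are bounded above and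
    away from 0. Hence [mobs zs] and [mobs ws] dominate each other and the two lists are
    permutations of one another. The last identity excludes the zeros because it is obtained by
    cancelling [mobs zs]. *)
Lemma factorization_zeros (C : R) p b zs phi s o : 0 < C -> in_disc b -> all_disc zs ->
  inner_outer_factorization (fun z => C%:C * mobs zs z / (1 - b * z) ^+ p) phi s o ->
  exists c : R[i], [/\ normc c = 1, forall z, in_disc z -> phi z = c * mobs zs z &
    forall z, in_disc z -> z \notin zs ->
      c * (s z * o z) = C%:C / (1 - b * z) ^+ p].
Proof.
move=> C0 b1 hz [bphi [ss [oo fE]]].
have Cc0 : C%:C != 0 :> R[i] by rewrite fmorph_eq0 gt_eqF.
have den0 z : in_disc z -> (1 - b * z) ^+ p != 0.
  by move=> z1; rewrite expf_neq0// sub1_neq0// normcM_lt1.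
have phi0 z : in_disc z -> phi z = 0 -> z \in zs.
  move=> z1 pz; rewrite -(mobs_eq0 hz (ltW z1)).
  have := fE z z1; rewrite pz !mul0r => /eqP.
  by rewrite !mulf_eq0 invr_eq0 (negbTE Cc0) (negbTE (den0 z z1)) orbF.
have [c [ws [c1 hw phiE]]] := blaschke_finite bphi hz phi0.
have nfE z : in_disc z -> C * normc (mobs zs z) / normc (1 - b * z) ^+ p =
    normc (mobs ws z) * normc (s z) * normc (o z).
  move=> z1; have := congr1 (fun w => normc w) (fE z z1).
  by rewrite phiE// !normcM c1 mul1r normcV normcX normcR gtr0_norm.
have dnb r z : normc z <= r -> r < 1 -> 0 < (1 - normc b) <= normc (1 - b * z).
  move=> zr r1; rewrite subr_gt0 b1/=.
  apply: le_trans (le_normc_dist _ _); rewrite normc1 lerD2l lerN2 normcM.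
  by rewrite ler_piMr ?normc_ge0// (le_trans zr)// ltW.
have dnb2 r z : normc z <= r -> r < 1 -> normc (1 - b * z) <= 2.
  move=> zr r1; apply: (le_trans (le_normcB _ _)); rewrite normc1 normcM.
  have : normc b * normc z <= 1.
    by rewrite mulr_ile1 ?normc_ge0// ?(ltW b1)// (le_trans zr)// ltW.
  lra.
have dom1 : dominated zs ws.
  move=> r r1; have [M1 M10 h1] := singular_inner_bound ss r1.
  have [M2 M20 h2] := outer_bound oo r1.
  exists (C^-1 * 2 ^+ p * (M1 * M2)) => z zr.
  have z1 : in_disc z by rewrite in_discE (le_lt_trans zr).
  have d0 : 0 < normc (1 - b * z) ^+ p.
    by have /andP[x y] := dnb r z zr r1; rewrite exprn_gt0// (lt_le_trans x y).
  have -> : normc (mobs zs z) = C^-1 * normc (1 - b * z) ^+ p * (normc (s z) * normc (o z))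
      * normc (mobs ws z).
    have := nfE z z1 => /(canRL (divfK (lt0r_neq0 d0))) e.
    apply: (mulfI (lt0r_neq0 C0)); rewrite e; field.
    by rewrite gt_eqF.
  rewrite ler_wpM2r ?normc_ge0//.
  have /andP[_ ?] := h1 z zr; have /andP[_ ?] := h2 z zr.
  apply: ler_pM; rewrite ?mulr_ge0 ?invr_ge0 ?exprn_ge0 ?normc_ge0 ?(ltW C0)//.
    rewrite ler_wpM2l ?invr_ge0 ?(ltW C0)// lerXn2r ?nnegrE ?normc_ge0//.
    exact: dnb2 zr r1.
  by apply: ler_pM; rewrite ?normc_ge0.
have dom2 : dominated ws zs.
  move=> r r1; have [M1 M10 h1] := singular_inner_bound ss r1.
  have [M2 M20 h2] := outer_bound oo r1.
  exists (C * ((1 - normc b) ^+ p)^-1 * (M1 * M2)) => z zr.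
  have z1 : in_disc z by rewrite in_discE (le_lt_trans zr).
  have /andP[b0 bz] := dnb r z zr r1.
  have d0 : 0 < normc (1 - b * z) ^+ p by rewrite exprn_gt0// (lt_le_trans b0 bz).
  have /andP[s0 _] := h1 z zr; have /andP[ox _] := h2 z zr.
  have s0' : 0 < normc (s z) by apply: lt_le_trans s0; rewrite invr_gt0.
  have o0' : 0 < normc (o z) by apply: lt_le_trans ox; rewrite invr_gt0.
  have -> : normc (mobs ws z) = C * (normc (1 - b * z) ^+ p)^-1 *
      ((normc (s z))^-1 * (normc (o z))^-1) * normc (mobs zs z).
    have := nfE z z1 => e.
    apply: (mulIf (lt0r_neq0 s0')); apply: (mulIf (lt0r_neq0 o0')); rewrite -e; field.
    by rewrite !gt_eqF// expf_neq0 ?gt_eqF.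
  rewrite ler_wpM2r ?normc_ge0//.
  apply: ler_pM; rewrite ?mulr_ge0 ?invr_ge0 ?exprn_ge0 ?normc_ge0 ?(ltW C0)//.
    rewrite ler_wpM2l ?(ltW C0)// lef_pV2 ?posrE ?exprn_gt0//.
      by rewrite lerXn2r ?nnegrE ?normc_ge0 ?(ltW b0).
    exact: lt_le_trans b0 bz.
  apply: ler_pM; rewrite ?invr_ge0 ?normc_ge0//.
    by rewrite -[leRHS]invrK lef_pV2 ?posrE ?invr_gt0.
  by rewrite -[leRHS]invrK lef_pV2 ?posrE ?invr_gt0.
have [r1 p1] := dominated_size hz hw dom1.
have [r2 p2] := dominated_size hw hz dom2.
(* Each list contains the other, so comparing lengths leaves no remainder. *)
have r10 : r1 = [::].
  apply: size0nil; have := perm_size p1; have := perm_size p2; rewrite !size_cat.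
  move=> -> /eqP; rewrite -addnA -[X in X == _]addn0 eqn_add2l eq_sym addn_eq0.
  by move=> /andP[_ /eqP].
have zw : perm_eq zs ws by move: p1; rewrite r10 cats0.
have phiE' z : in_disc z -> phi z = c * mobs zs z.
  by move=> /phiE ->; rewrite (mobs_perm _ zw).
exists c; split => // z z1 zz.
have m0 : mobs zs z != 0 by rewrite mobs_eq0// ltW.
apply: (mulfI m0); have := fE z z1; rewrite phiE'// => e.
rewrite (_ : mobs zs z * _ = c * mobs zs z * s z * o z); last by ring.
by rewrite -e mulrAC mulrC.
Qed.

End ZeroUniqueness.

(** * Poisson means *)

Section PoissonKernel.
Variable R : realType.
Local Notation lam := (@lebesgue_measure R).
Local Notation T := (measurableTypeR R).
Local Notation I02pi := (`[0%R, (2 * pi)%R]%classic : set (measurableTypeR R)).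
Local Notation J02pi := (`[0%R, (2 * pi)%R[%classic : set (measurableTypeR R)).

Lemma Re_herglotz_kernel_ge0 (t : R) (z : R[i]) : in_disc z -> 0 <= Re (herglotz_kernel t z).
Proof.
rewrite in_discE => z1; rewrite /herglotz_kernel ReM ReV ImV.
have -> : Re (expi t + z) * (Re (expi t - z) / (Re (expi t - z) ^+ 2 + Im (expi t - z) ^+ 2)) -
    Im (expi t + z) * - (Im (expi t - z) / (Re (expi t - z) ^+ 2 + Im (expi t - z) ^+ 2)) =
    (normc (expi t) ^+ 2 - normc z ^+ 2) / (Re (expi t - z) ^+ 2 + Im (expi t - z) ^+ 2).
  by rewrite !normc_sqr !ReD !ImD !ReN !ImN; ring.
rewrite normc_expi expr1n; apply: divr_ge0; last by rewrite addr_ge0 ?sqr_ge0.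
by rewrite subr_ge0 expr_le1 ?normc_ge0// ltW.
Qed.

(* The Poisson kernel [(1 - r^2) / |1 - r e^{ix}|^2]. *)
Definition poisson (r x : R) : R := Re ((1 + r%:C * expi (- x)) / (1 - r%:C * expi (- x))).

Lemma Re_herglotz_poisson (r t th : R) :
  Re (herglotz_kernel t (r%:C * expi th)) = poisson r (t - th).
Proof.
rewrite /poisson /herglotz_kernel opprB [th - t]addrC expiD expiN expi_conj.
have e0 := expi_neq0 t; congr Re.
have -> : expi t + r%:C * expi th = expi t * (1 + r%:C * ((expi t)^-1 * expi th)).
  by rewrite mulrDr mulr1; congr (_ + _); rewrite mulrCA mulVKf.
have -> : expi t - r%:C * expi th = expi t * (1 - r%:C * ((expi t)^-1 * expi th)).
  by rewrite mulrBr mulr1; congr (_ - _); rewrite mulrCA mulVKf.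
by rewrite invfM mulrACA divff// mul1r.
Qed.

Lemma normcR_lt1 (r : R) : 0 <= r < 1 -> normc r%:C < 1.
Proof. by move=> /andP[r0 r1]; rewrite normcR ger0_norm. Qed.

Lemma in_disc_polar (r t : R) : 0 <= r < 1 -> in_disc (r%:C * expi t).
Proof. by move=> /normcR_lt1 h; rewrite in_discE normcM_expi. Qed.

Lemma cont_poisson (r : R) : 0 <= r < 1 -> continuous (poisson r).
Proof.
move=> r01; have r1 := normcR_lt1 r01.
have cw : ccont (fun x : R => r%:C * expi (- x)).
  under eq_fun do rewrite expiN.
  move=> x; apply: ctendsM; first exact: ctends_cst.
  by apply: ctendsJ; exact: ccont_expi.
apply: ccont_Re; apply: ccontM; first by apply: ccontD => //; exact: ccont_cst.
apply: ccontV => [x|]; first exact: sub1_expi_neq0.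
by apply: ccontB => //; exact: ccont_cst.
Qed.

Lemma poisson_bound (r x : R) : 0 <= r < 1 -> `|poisson r x| <= 2 / (1 - r).
Proof.
move=> r01; have := Re_herglotz_poisson r x 0; rewrite subr0 => <-.
apply: (le_trans (le_Re_normc _)); apply: (le_trans (normc_herglotz_kernel _ _)).
  exact: in_disc_polar.
by rewrite normcM_expi normcR ger0_norm//; case/andP: r01.
Qed.

(** The integration is in the angle of the point, not in that of the kernel. In this variable the
    Herglotz kernel is 1 + 2 b w/(1 - b w) with b = r e^(-it), whose second term has mean 0. *)
Lemma integral_poisson (r t : R) : 0 <= r < 1 ->
  \int[lam]_(th in I02pi) poisson r (t - th) = 2 * pi.
Proof.
move=> r01; have r1 := normcR_lt1 r01.
under eq_Rintegral do rewrite -Re_herglotz_poisson.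
pose b : R[i] := r%:C / expi t.
have b1 : normc b < 1 by rewrite normcM normcV normc_expi divr1.
have KE th : herglotz_kernel t (r%:C * expi th) = 1 + 2 * b * (expi th / (1 - b * expi th)).
  have e0 := expi_neq0 t.
  have d0 : expi t - r%:C * expi th != 0.
    by apply: expi_sub_neq0; rewrite normcM_expi.
  have d1 : 1 - b * expi th != 0 by exact: sub1_expi_neq0.
  have bE : r%:C = b * expi t by rewrite divfK.
  rewrite /herglotz_kernel bE; field; rewrite d1/=.
  by move: d0; rewrite bE.
have cf : ccont (fun th => expi th / (1 - b * expi th)).
  by apply: ccontM; [exact: ccont_expi|exact: ccont_sub1_inv].
have cE : circ (fun th => 1 + 2 * b * (expi th / (1 - b * expi th))) = (2 * pi)%:C.
  rewrite circD; [|exact: ccont_cst|by apply: ccontM => //; exact: ccont_cst].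
  by rewrite circ_cst circZ// circ_outer_pole// mulr0 addr0 mulr1.
transitivity (\int[lam]_(th in I02pi) Re (1 + 2 * b * (expi th / (1 - b * expi th)))).
  by apply: eq_Rintegral => th _; rewrite KE.
exact: (congr1 (@complex.Re R) cE).
Qed.

(** Fubini's theorem is applied on the full product space, with the domains encoded as indicators;
    this turns an indicator back into a domain. *)
Lemma integral_indic_mul d (X : measurableType d) (m : {measure set X -> \bar R})
    (D : set X) (g : X -> R) :
  (\int[m]_x (\1_D x * g x)%:E = \int[m]_(x in D) (g x)%:E)%E.
Proof.
rewrite [RHS]integral_mkcond; apply: eq_integral => x _.
rewrite patchE indicE; by case: ifPn => _; rewrite ?mul1r ?mul0r.
Qed.

Lemma EFin_Rintegral d (X : measurableType d) (m : {measure set X -> \bar R})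
    (D : set X) (g : X -> R) : measurable D -> m.-integrable D (EFin \o g) ->
  (\int[m]_(x in D) (g x)%:E = (\int[m]_(x in D) g x)%R%:E)%E.
Proof. by move=> mD ig; rewrite fineK//; exact: integrable_fin_num. Qed.

Section fubini.
Variable nu : {sigma_finite_measure set T -> \bar R}.
Variables (k : R -> R) (r : R).
Hypothesis r01 : 0 <= r < 1.
Hypothesis ik : nu.-integrable J02pi (EFin \o k).

Let mI : measurable I02pi. Proof. by []. Qed.
Let mJ : measurable J02pi. Proof. by []. Qed.
Let kk (t : T) : R := \1_J02pi t * k t.
Let F (x : T * T) : \bar R := (\1_I02pi x.1 * (poisson r (x.2 - x.1) * kk x.2))%:E.
Let U (th : T) : R := \int[nu]_(t in J02pi) (poisson r (t - th) * k t).

Let mkk : measurable_fun setT kk.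
Proof.
have mk : measurable_fun J02pi k.
  by apply/measurable_EFinP; exact: (measurable_int nu ik).
have := (measurable_restrictT k mJ).1 mk; apply: eq_measurable_fun => t _.
rewrite /kk patchE indicE; by case: ifPn => _; rewrite ?mul1r ?mul0r.
Qed.

Let mF : measurable_fun setT F.
Proof.
apply/measurable_EFinP; apply: measurable_funM.
  apply: measurableT_comp; [exact: measurable_indic|exact: measurable_fst].
apply: measurable_funM; last by apply: measurableT_comp; [exact: mkk|exact: measurable_snd].
apply: (measurableT_comp (f := poisson r)); first exact: cont_measurable (cont_poisson r01).
by apply: measurable_funB; [exact: measurable_snd|exact: measurable_fst].
Qed.

Let ipk (th : R) : nu.-integrable J02pi (EFin \o (fun t => poisson r (t - th) * k t)).
Proof.
apply: (@integrable_bounded_mul _ _ _ _ (2 / (1 - r))) => //.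
- move=> t; apply: (@continuous_comp _ _ _ (fun t => t - th) (poisson r)).
    by apply: cvgB; [exact: cvg_id|exact: cvg_cst].
  exact: cont_poisson.
- by move=> t; exact: poisson_bound.
Qed.

Let inner_t (th : T) : (\int[nu]_t F (th, t) = (\1_I02pi th * U th)%:E)%E.
Proof.
under eq_integral => t _.
  rewrite /F /= /kk (_ : _ * _ = \1_J02pi t * (\1_I02pi th * (poisson r (t - th) * k t))).
    over.
  by ring.
rewrite integral_indic_mul EFin_Rintegral//; first by rewrite RintegralZl.
have := integrableZl mJ (\1_I02pi th) (ipk th).
exact: eq_integrable.
Qed.

Let inner_th (t : T) : (\int[lam]_th F (th, t) = (\1_J02pi t * (2 * pi * k t))%:E)%E.
Proof.
have cp : continuous (fun th : R => poisson r (t - th)).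
  move=> th; apply: (@continuous_comp _ _ _ (fun th => t - th) (poisson r)).
    by apply: cvgB; [exact: cvg_cst|exact: cvg_id].
  exact: cont_poisson.
have ip := cont_integrable cp.
rewrite /F /= integral_indic_mul EFin_Rintegral//.
  rewrite RintegralZr// integral_poisson// /kk; congr EFin; ring.
have := integrableZr mI (kk t) ip.
exact: eq_integrable.
Qed.

(** For fixed r < 1 the Poisson kernel is at most 2/(1 - r), so the iterated absolute integral is at
    most 2 pi times 2/(1 - r) times the integral of |k|. *)
Let integrable_F : (lam \x nu)%E.-integrable setT F.
Proof.
have ikk : nu.-integrable setT (EFin \o kk).
  have := (integrable_restrict nu mJ measurableT (EFin \o k)).1.
  rewrite setTI => /(_ ik); apply: eq_integrable => // t _.
  rewrite /kk /= patchE indicE; by case: ifPn => _; rewrite ?mul1r ?mul0r.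
have /integrableP[_ fin] := ikk.
have B0 : 0 <= 2 / (1 - r) by case/andP: r01 => _ h; rewrite divr_ge0// subr_ge0 ltW.
pose n := fine (\int[nu]_t `|(kk t)%:E|)%E.
have nE : (\int[nu]_t `|(kk t)%:E| = n%:E)%E.
  by rewrite /n fineK// ge0_fin_numE//; exact: integral_ge0.
apply/(integrable12ltyP _ _ mF).
apply: (@le_lt_trans _ _ (\int[lam]_th (\1_I02pi th * (2 / (1 - r) * n))%:E)%E).
  apply: ge0_le_integral => //.
  - by move=> th _; exact: integral_ge0.
  - apply: (measurable_fun_fubini_tonelli_F (fun x => `|F x|)%E) => //.
    exact: measurableT_comp.
  - apply/measurable_EFinP; apply: measurable_funM => //; exact: measurable_indic.
  move=> th _.
  have -> : (\1_I02pi th * (2 / (1 - r) * n))%:E =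
      (\int[nu]_t ((\1_I02pi th * (2 / (1 - r)))%:E * `|(kk t)%:E|))%E.
    rewrite ge0_integralZl//.
    - by rewrite nE -EFinM mulrA.
    - by do 2 apply: measurableT_comp => //.
    - by rewrite lee_fin mulr_ge0.
  apply: ge0_le_integral => //.
  - apply: measurableT_comp => //.
    exact: (measurableT_comp mF (measurable_pair1 th)).
  - apply: emeasurable_funM => //; do 2 apply: measurableT_comp => //.
  move=> t _; rewrite /F /= lee_fin !normrM (ger0_norm (_ : 0 <= \1_I02pi th))//.
  rewrite -mulrA ler_wpM2l// ler_wpM2r//.
  exact: poisson_bound.
rewrite integral_indic_mul integral_cst//= lebesgue_I02pi.
by rewrite -EFinM ltry.
Qed.

Lemma poisson_mean_integrable : lam.-integrable I02pi (EFin \o U).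
Proof.
have h : lam.-integrable setT (fun th => (\1_I02pi th * U th)%:E).
  by have := integrable_fubini_F integrable_F; apply: eq_integrable => // th _; exact: inner_t.
have := integrableS measurableT mI (@subsetT _ _) h.
by apply: eq_integrable => // th thI /=; rewrite indicE thI mul1r.
Qed.

(** Exchanging the integrals, the Poisson kernel is integrated in the angle of the point first,
    which gives 2 pi whatever t is. *)
Lemma poisson_mean :
  \int[lam]_(th in I02pi) U th = 2 * pi * \int[nu]_(t in J02pi) k t.
Proof.
have := Fubini integrable_F.
under eq_integral do rewrite inner_t.
under [X in _ = X -> _]eq_integral do rewrite inner_th.
rewrite !integral_indic_mul => h; rewrite -RintegralZl//.
by rewrite /Rintegral h.
Qed.

End fubini.

Lemma herglotz_mean (nu : {sigma_finite_measure set T -> \bar R}) (k : R -> R) (r : R) :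
  0 <= r < 1 -> nu.-integrable J02pi (EFin \o k) ->
  lam.-integrable I02pi (EFin \o (fun th => Re (herglotz nu k (r%:C * expi th)))) /\
  \int[lam]_(th in I02pi) Re (herglotz nu k (r%:C * expi th)) =
    2 * pi * \int[nu]_(t in J02pi) k t.
Proof.
move=> r01 ik.
have UE : (fun th => Re (herglotz nu k (r%:C * expi th))) =
    (fun th => \int[nu]_(t in J02pi) (poisson r (t - th) * k t)).
  apply/funext => th; rewrite Re_herglotz; apply: eq_Rintegral => t _.
  by rewrite Re_herglotz_poisson.
rewrite UE; split; first exact: poisson_mean_integrable.
exact: poisson_mean.
Qed.

Section finite_measure.
Variable nu : {measure set T -> \bar R}.
Hypothesis nufin : (nu setT < +oo)%E.

Let nu_fin_num : fin_num_fun nu. Proof. exact: lty_fin_num_fun. Qed.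
(** An alias to carry the finite measure structure that Fubini's theorem requires; [nu] itself is
    declared as a bare measure. *)
Let nuf : set T -> \bar R := nu.
HB.instance Definition _ := Measure.on nuf.
HB.instance Definition _ := Measure_isFinite.Build _ _ _ nuf nu_fin_num.

Lemma herglotz_mean_finite (k : R -> R) (r : R) :
  0 <= r < 1 -> nu.-integrable J02pi (EFin \o k) ->
  lam.-integrable I02pi (EFin \o (fun th => Re (herglotz nu k (r%:C * expi th)))) /\
  \int[lam]_(th in I02pi) Re (herglotz nu k (r%:C * expi th)) =
    2 * pi * \int[nu]_(t in J02pi) k t.
Proof. exact: (@herglotz_mean nuf). Qed.

End finite_measure.

End PoissonKernel.

(** * Triviality of the singular part *)

Section SingularMass.
Variable R : realType.
Local Notation lam := (@lebesgue_measure R).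
Local Notation T := (measurableTypeR R).
Local Notation I02pi := (`[0%R, (2 * pi)%R]%classic : set (measurableTypeR R)).
Local Notation J02pi := (`[0%R, (2 * pi)%R[%classic : set (measurableTypeR R)).
Implicit Types (nu : {measure set T -> \bar R}) (h k : R -> R).

Let mI : measurable I02pi. Proof. by []. Qed.
Let mJ : measurable J02pi. Proof. by []. Qed.

Lemma Re_herglotzD nu h k z : in_disc z -> nu.-integrable J02pi (EFin \o h) ->
  nu.-integrable J02pi (EFin \o k) ->
  Re (herglotz nu (fun t => h t + k t) z) = Re (herglotz nu h z) + Re (herglotz nu k z).
Proof.
move=> z1 ih ik; rewrite !Re_herglotz -RintegralD//; try exact: integrable_Re_herglotz.
by apply: eq_Rintegral => t _; rewrite mulrDr.
Qed.

Lemma Re_herglotzZ nu (c : R) k z : in_disc z -> nu.-integrable J02pi (EFin \o k) ->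
  Re (herglotz nu (fun t => c * k t) z) = c * Re (herglotz nu k z).
Proof.
move=> z1 ik; rewrite !Re_herglotz -RintegralZl//; last exact: integrable_Re_herglotz.
by apply: eq_Rintegral => t _; rewrite mulrCA.
Qed.

Lemma le_Re_herglotz nu h k z : in_disc z -> nu.-integrable J02pi (EFin \o h) ->
  nu.-integrable J02pi (EFin \o k) -> (forall t, h t <= k t) ->
  Re (herglotz nu h z) <= Re (herglotz nu k z).
Proof.
move=> z1 ih ik hk; rewrite !Re_herglotz; apply: le_Rintegral => //.
- exact: integrable_Re_herglotz.
- exact: integrable_Re_herglotz.
- by move=> t _; rewrite ler_wpM2l// Re_herglotz_kernel_ge0.
Qed.

Lemma Re_herglotz_ge0 nu k z : in_disc z -> (forall t, 0 <= k t) ->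
  0 <= Re (herglotz nu k z).
Proof.
move=> z1 k0; rewrite Re_herglotz; apply: Rintegral_ge0 => t _.
by rewrite mulr_ge0// Re_herglotz_kernel_ge0.
Qed.

Lemma Re_herglotz_cst (c : R) z : in_disc z ->
  Re (herglotz lam (fun=> c) z) = 2 * pi * c.
Proof.
move=> z1; rewrite herglotz_lebesgue//; last by move=> t; exact: cvg_cst.
under eq_fun do rewrite mulrC.
rewrite circZ; last exact: ccont_herglotz_kernel.
by rewrite circ_herglotz// ReM/= mul0r subr0 mulrC.
Qed.

Definition truncation (N : R) h (t : R) : R := Num.max (- N) (Num.min (h t) N).

Lemma truncation_le N h t : 0 <= N -> `|truncation N h t| <= N.
Proof.
move=> N0; rewrite /truncation ler_norml le_max lexx/= ge_max ge_min lexx orbT andbT.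
by rewrite (le_trans _ N0)// oppr_le0.
Qed.

Lemma truncation_id N h t : `|h t| <= N -> truncation N h t = h t.
Proof. by rewrite ler_norml /truncation => /andP[a b]; rewrite min_l// max_r. Qed.

Lemma truncation_dist N h t : 0 <= N -> `|h t - truncation N h t| <= `|h t|.
Proof.
move=> N0; rewrite /truncation; have [hN|hN] := leP (h t) N.
  have [nh|nh] := leP (- N) (h t); first by rewrite subrr normr0.
  have h0 : h t < 0 by rewrite (lt_le_trans nh)// oppr_le0.
  rewrite (ltr0_norm h0) opprK ler0_norm; lra.
rewrite max_r; last by rewrite (le_trans _ N0)// oppr_le0.
by rewrite (ger0_norm (_ : 0 <= h t)) ?ger0_norm; lra.
Qed.

Lemma measurable_truncation N h : measurable_fun J02pi h ->
  measurable_fun J02pi (truncation N h).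
Proof.
move=> mh; apply: measurable_maxr; first exact: measurable_cst.
by apply: measurable_minr => //; exact: measurable_cst.
Qed.

Lemma integrable_truncation N h : 0 <= N -> lam.-integrable J02pi (EFin \o h) ->
  lam.-integrable J02pi (EFin \o (fun t => h t - truncation N h t)).
Proof.
move=> N0 ih; have mh : measurable_fun J02pi h.
  by apply/measurable_EFinP; exact: (measurable_int lam ih).
apply: le_integrable ih => //.
  by apply/measurable_EFinP; apply: measurable_funB => //; exact: measurable_truncation.
by move=> t _; rewrite /= lee_fin truncation_dist.
Qed.

(** The remainder at t is exactly 0 once N >= |h t|, and it is dominated by |h|, so dominated
    convergence applies along the integers N. *)
Lemma truncation_small h (e : R) : 0 < e -> lam.-integrable J02pi (EFin \o h) ->
  exists2 N, 0 <= N & \int[lam]_(t in J02pi) `|h t - truncation N h t| <= e.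
Proof.
move=> e0 ih; have mh : measurable_fun J02pi h.
  by apply/measurable_EFinP; exact: (measurable_int lam ih).
pose f_ (n : nat) (t : T) : \bar R := (h t - truncation n%:R h t)%:E.
have [] := @dominated_convergence _ T R lam J02pi mJ f_ (cst 0%E)
  (EFin \o (fun t => `|h t|)) _ _ _ _ _.
- move=> n; apply/measurable_EFinP; apply: measurable_funB => //.
  exact: measurable_truncation.
- exact: measurable_cst.
- apply/aeW => t _ /=; apply: cvg_near_cst; near=> n.
  rewrite /f_ truncation_id ?subrr//; near: n.
  exact: nbhs_infty_ger.
- exact: integrable_norm.
- by apply/aeW => t n _ /=; rewrite lee_fin truncation_dist.
move=> _ /fine_cvgP[_ /cvgrPdist_le/(_ _ e0)[n _ /(_ n (leqnn n))]] /= hn _.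
exists n%:R => //; apply: le_trans hn; rewrite sub0r normrN.
apply: le_trans (ler_norm _); rewrite le_eqVlt; apply/orP; left; apply/eqP.
by rewrite /Rintegral; congr fine; apply: eq_integral => t _; rewrite subr0.
Unshelve. all: by end_near. Qed.

Section mass.
Variables (nu : {measure set T -> \bar R}) (h : R -> R) (r0 : R).
Hypothesis nufin : (nu setT < +oo)%E.
Hypothesis ih : lam.-integrable J02pi (EFin \o h).
Hypothesis r00 : 0 <= r0 < 1.
Hypothesis eq_poisson : forall r t : R, r0 < r < 1 ->
  Re (herglotz nu (fun=> 1) (r%:C * expi t)) = Re (herglotz lam h (r%:C * expi t)).
Hypothesis lim0 : {ae lam, forall t : R, 0 < t < 2 * pi ->
  Re (herglotz nu (fun=> 1) (r%:C * expi t)) @[r --> 1^'-] --> (0 : R)}.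

(** Radii increasing to 1; the offset 2 keeps even the first one strictly above [r0], as
    [eq_poisson] requires. *)
Let radius (n : nat) : R := 1 - (1 - r0) / n.+2%:R.
Let u n (t : R) : R := Re (herglotz nu (fun=> 1) ((radius n)%:C * expi t)).

Let radius_lt n : r0 < radius n < 1.
Proof.
have /andP[a b] := r00; have n0 : 0 < n.+2%:R :> R by rewrite ltr0n.
rewrite /radius; apply/andP; split; last first.
  by rewrite ltrBlDr ltrDl divr_gt0// subr_gt0.
rewrite ltrBrDl -ltrBrDr ltr_pdivrMr//.
by rewrite -[ltLHS]mulr1 ltr_pM2l ?subr_gt0// ltr1n.
Qed.

Let radius01 n : 0 <= radius n < 1.
Proof.
by have /andP[a b] := radius_lt n; rewrite b andbT (le_trans _ (ltW a))//; case/andP: r00.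
Qed.

Let radius_cvg : radius n @[n --> \oo] --> (1 : R).
Proof.
rewrite -[X in _ --> X]subr0; apply: cvgB; first exact: cvg_cst.
rewrite -[X in _ --> X](mulr0 (1 - r0)); apply: cvgM; first exact: cvg_cst.
rewrite (_ : (fun n => _) = (fun n => (@harmonic R (n + 1)%N))); last first.
  by apply/funext => n; rewrite /harmonic/= addn1.
by rewrite (cvg_shiftn 1); exact: cvg_harmonic.
Qed.

Let ione : nu.-integrable J02pi (EFin \o (fun=> 1 : R)).
Proof.
apply: integrable_cst1; apply: le_lt_trans nufin.
by apply: le_measure; rewrite ?inE//; exact: measurableT.
Qed.

Let u_ge0 n t : 0 <= u n t.
Proof. by apply: Re_herglotz_ge0 => // ; exact: in_disc_polar. Qed.

Let iu n : lam.-integrable I02pi (EFin \o u n).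
Proof. by have [] := herglotz_mean_finite nufin (radius01 n) ione. Qed.

Let mu_trunc M n : measurable_fun I02pi (fun t => Num.min (u n t) M).
Proof.
apply: measurable_minr; last exact: measurable_cst.
by apply/measurable_EFinP; exact: (measurable_int lam (iu n)).
Qed.

Let trunc_le M n t : 0 <= M -> `|Num.min (u n t) M| <= M.
Proof. by move=> M0; rewrite ger0_norm ?ge_min ?lexx ?orbT// le_min u_ge0. Qed.

Let icst (M : R) : lam.-integrable I02pi (EFin \o (fun=> M)).
Proof. by apply: cont_integrable => t; exact: cvg_cst. Qed.

Let itrunc M n : 0 <= M -> lam.-integrable I02pi (EFin \o (fun t => Num.min (u n t) M)).
Proof.
move=> M0; apply: le_integrable (icst M) => //; first exact/measurable_EFinP.
by move=> t _; rewrite /= lee_fin (le_trans (trunc_le _ _ M0))// ler_norm.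
Qed.

(** Dominated convergence with the constant M: the radial limits 0 are sampled along [radius], the
    two endpoints being discarded as a null set. *)
Let trunc_cvg M : 0 <= M ->
  \int[lam]_(t in I02pi) Num.min (u n t) M @[n --> \oo] --> (0 : R).
Proof.
move=> M0.
have [] := @dominated_convergence _ T R lam I02pi mI
  (fun n t => (Num.min (u n t) M)%:E) (cst 0%E) (EFin \o (fun=> M)) _ _ _ _ _.
- by move=> n; exact/measurable_EFinP.
- exact: measurable_cst.
- have := aeI lim0 (aeI (ae_neq 0) (ae_neq (2 * pi))); apply: aeS => t [l [t0 t2]] /=.
  rewrite in_itv/= => /andP[t0' t2'].
  have t02 : 0 < t < 2 * pi by rewrite !lt_neqAle eq_sym t0 t0' t2 t2'.
  have ul : u n t @[n --> \oo] --> (0 : R).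
    move/cvg_at_leftP : (l t02); apply; split; last exact: radius_cvg.
    by move=> n; case/andP: (radius01 n).
  apply: cvg_EFin; first exact: nearW.
  by apply: (cvg0_le_norm ul) => n /=; rewrite ger0_norm ?ge_min ?lexx// le_min u_ge0.
- exact: icst.
- by apply/aeW => t n _ /=; rewrite lee_fin trunc_le.
move=> _ _; rewrite integral0 => /fine_cvgP[_]; exact.
Qed.

(* The functions [u n] tend to 0 almost everywhere and are uniformly integrable,
   since [h] is integrable, whereas their mean is the mass of [nu]. *)
Lemma poisson_limit0_mass : \int[nu]_(t in J02pi) (1 : R) = 0.
Proof.
set m := (LHS).
have m0 : 0 <= m by apply: Rintegral_ge0.
have um n : \int[lam]_(t in I02pi) u n t = 2 * pi * m.
  by have [] := herglotz_mean_finite nufin (radius01 n) ione.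
apply/eqP; rewrite eq_le m0 andbT; apply/ler_addgt0Pl => e e0; rewrite addr0.
have [N N0 wN] := truncation_small e0 ih.
pose w t := h t - truncation N h t.
(* As [herglotz] has no factor 1/(2 pi), the constant N has Poisson integral 2 pi N, which bounds
   that of the truncation of h. *)
pose M := 2 * pi * N.
have M0 : 0 <= M by rewrite /M mulr_ge0// ltW// twopi_gt0.
have iw : lam.-integrable J02pi (EFin \o w) by exact: integrable_truncation.
have iw' : lam.-integrable J02pi (EFin \o (fun t => `|w t|)) by exact: integrable_norm.
have it : lam.-integrable J02pi (EFin \o truncation N h).
  have := integrableB mJ ih iw; apply: eq_integrable => // t _ /=.
  by rewrite /w -EFinB opprB addrC subrK.
have icN : lam.-integrable J02pi (EFin \o (fun=> N)).
  by apply: cont_integrable_co => t; exact: cvg_cst.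
pose W n t := Re (herglotz lam (fun t => `|w t|) ((radius n)%:C * expi t)).
(* If u n t <= M, the minimum is u n t and W n t >= 0. Otherwise the minimum is M, which bounds the
   contribution of the truncation, while W n t bounds that of the remainder w. *)
have uW n t : u n t <= Num.min (u n t) M + W n t.
  have d1 := in_disc_polar t (radius01 n).
  have W0 : 0 <= W n t by apply: Re_herglotz_ge0.
  have uE : u n t = Re (herglotz lam (truncation N h) ((radius n)%:C * expi t)) +
      Re (herglotz lam w ((radius n)%:C * expi t)).
    rewrite /u eq_poisson// -Re_herglotzD//; congr (Re (herglotz _ _ _)).
    by apply/funext => s; rewrite /w addrC subrK.
  have vM : Re (herglotz lam (truncation N h) ((radius n)%:C * expi t)) <= M.
    rewrite /M -(Re_herglotz_cst N d1); apply: le_Re_herglotz => // s.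
    by rewrite (le_trans (ler_norm _))// truncation_le.
  have wW : Re (herglotz lam w ((radius n)%:C * expi t)) <= W n t.
    by apply: le_Re_herglotz => // s; exact: ler_norm.
  by have [uM|uM] := leP (u n t) M; [rewrite lerDl|rewrite uE lerD].
(* Integrating the previous inequality: u n has integral 2 pi m, and W n has integral 2 pi times
   that of |w|, hence at most 2 pi e. *)
have step n : 2 * pi * m - 2 * pi * e <= \int[lam]_(t in I02pi) Num.min (u n t) M.
  have [iW WE] := @herglotz_mean R lebesgue_measure _ _ (radius01 n) iw'.
  rewrite lerBlDr -(um n).
  apply: (@le_trans _ _ (\int[lam]_(t in I02pi) (Num.min (u n t) M + W n t))).
    have isum : lam.-integrable I02pi (EFin \o (fun t => Num.min (u n t) M + W n t)).
      by have := integrableD mI (itrunc n M0) iW; apply: eq_integrable.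
    exact: (le_Rintegral mI (iu n) isum (fun t _ => uW n t)).
  rewrite RintegralD//; last exact: itrunc.
  by rewrite lerD2l WE ler_pM2l// twopi_gt0.
have : 2 * pi * m - 2 * pi * e <= 0.
  by apply: (cvgr_to_ge (trunc_cvg M0)); apply: nearW => n; exact: step.
by rewrite -mulrBr pmulr_rle0 ?twopi_gt0// subr_le0.
Qed.

End mass.
End SingularMass.

(** * Mean-frequency *)

Section MeanFrequency.
Variable R : realType.
Local Notation lam := (@lebesgue_measure R).
Local Notation T := (measurableTypeR R).
Local Notation J02pi := (`[0%R, (2 * pi)%R[%classic : set (measurableTypeR R)).
Implicit Types (b z : R[i]) (zs : seq R[i]).

Lemma zero_free_annulus zs : all_disc zs ->
  exists2 r0 : R, 0 <= r0 < 1 & forall z, r0 < normc z -> z \notin zs.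
Proof.
move=> /all_disc_gap[d d0 dz]; exists (Num.max 0 (1 - d)).
  by rewrite le_max lexx gt_max ltr01/= ltrBlDr ltrDl.
move=> z; rewrite gt_max => /andP[_ h]; apply/negP => /dz; lra.
Qed.

(** Logarithms of moduli in c s o = C/(1 - b z)^p express the Poisson integral of the measure of s,
    off the zeros, as that of an integrable function; the phase of s provides its radial limits. *)
Lemma singular_part_constant (C : R) p b zs phi s o th : 0 < C -> in_disc b -> all_disc zs ->
  inner_outer_factorization (fun z => C%:C * mobs zs z / (1 - b * z) ^+ p) phi s o ->
  is_phase s th ->
  exists2 c : R[i], normc c = 1 & forall z, in_disc z -> s z = c.
Proof.
move=> C0 b1 hz fact [lims _].
have [c [c1 _ soE]] := factorization_zeros C0 b1 hz fact.
have [_ [/is_singular_innerP[cs [nu [cs1 ione nuC nufin sE]]] [/is_outerP[co [k [co1 ik oE]]] _]]] := fact.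
have mJ : measurable J02pi by [].
have nuT : (nu setT < +oo)%E.
  rewrite -(setUv J02pi) measureU//; [|exact: measurableC|exact: setICr].
  by rewrite [X in (_ + X)%E]nuC adde0.
have [r0 r01 hr0] := zero_free_annulus hz.
pose k0 := outer_log C p b.
have ik0 : lam.-integrable J02pi (EFin \o k0).
  by apply: cont_integrable_co; exact: cont_outer_log.
(* From - P[nu] + P[k]/(2 pi) = P[k0]/(2 pi), where P denotes the real part of [herglotz]. *)
pose h t := (2 * pi)^-1 * (k t + -1 * k0 t).
have iNk0 : lam.-integrable J02pi (EFin \o (fun t => -1 * k0 t)).
  by have := integrableZl mJ (-1) ik0; apply: eq_integrable.
have id0 : lam.-integrable J02pi (EFin \o (fun t => k t + -1 * k0 t)).
  by have := integrableD mJ ik iNk0; apply: eq_integrable.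
have ih : lam.-integrable J02pi (EFin \o h).
  by have := integrableZl mJ (2 * pi)^-1 id0; apply: eq_integrable.
have Rep (x : R) w : Re (x%:C * w) = x * Re w by rewrite ReM/= mul0r subr0.
have eq_poisson (r t : R) : r0 < r < 1 ->
    Re (herglotz nu (fun=> 1) (r%:C * expi t)) = Re (herglotz lam h (r%:C * expi t)).
  move=> /andP[r0r r1].
  have r00 : 0 <= r by case/andP: r01 => a _; rewrite (le_trans a)// ltW.
  have z1 : in_disc (r%:C * expi t) by apply: in_disc_polar; rewrite r00.
  have zz : r%:C * expi t \notin zs by apply: hr0; rewrite normcM_expi normcR ger0_norm.
  have := congr1 (fun w => normc w) (soE _ z1 zz).
  rewrite -cexp_herglotz_outer_log// sE// oE// mulrACA -cexpD mulrA.
  rewrite (normcM (c * (cs * co))) (normcM c) (normcM cs) c1 cs1 co1 !mul1r !normc_cexp.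
  move=> /expR_inj; rewrite ReD ReN !Rep Re_herglotzZ// Re_herglotzD// Re_herglotzZ//.
  lra.
(* In the disc this real part equals - ln |s|, and |s| tends to 1 wherever the radial limit is
   unimodular. *)
have lim0 : {ae lam, forall t : R, 0 < t < 2 * pi ->
    Re (herglotz nu (fun=> 1) (r%:C * expi t)) @[r --> 1^'-] --> (0 : R)}.
  move: lims; apply: aeS => t lt /lt /ctendsP /ctends_norm; rewrite normc_expi => l1.
  have l2 : - ln (normc (s (r%:C * expi t))) @[r --> 1^'-] --> (0 : R).
    by rewrite -oppr0 -(ln1 R); apply: cvgN; apply: cvg_ln.
  apply: cvg_trans l2; apply: near_eq_cvg; near=> r.
  have r0r : 0 <= r by near: r; apply: nbhs_left_ge; exact: ltr01.
  have r1 : r < 1 by near: r; exact: nbhs_left_lt.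
  rewrite sE; last by apply: in_disc_polar; rewrite r0r.
  by rewrite normcM cs1 mul1r normc_cexp expRK ReN /= opprK.
have m0 := poisson_limit0_mass nuT ih r01 eq_poisson lim0.
(* Finiteness of the measure matters here, since [fine] also sends an infinite mass to 0. *)
have nu0 : nu J02pi = 0%E.
  move: m0; rewrite Rintegral_cst// mul1r => /eqP; rewrite fine_eq0; first by move/eqP.
  by rewrite ge0_fin_numE.
exists cs => // z z1; rewrite sE//.
have cr := ccont_Re (ccont_herglotz_kernel z1); have ci := ccont_Im (ccont_herglotz_kernel z1).
have m1 (g : R -> R) : continuous g -> measurable_fun J02pi (fun t => (g t * 1)%:E).
  move=> cg; apply/measurable_EFinP; apply: cont_measurable.
  by under eq_fun do rewrite mulr1.
rewrite /herglotz !null_set_integral//; [|exact: m1|exact: m1].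
by rewrite /= (_ : 0 +i* 0 = 0)// oppr0 cexp0 mulr1.
Unshelve. all: by end_near. Qed.

(** In the disc, [phi] and [s] are unimodular constants times [mobs zs] and [mobs [::]]; writing the
    constants as [expi al] and [expi be] gives each a smooth phase [sphase] with which the given
    phases are compared. *)
Lemma mean_frequency_unique (C : R) p b zs phi s o th_phi th_s :
  0 < C -> in_disc b -> all_disc zs ->
  inner_outer_factorization (fun z => C%:C * mobs zs z / (1 - b * z) ^+ p) phi s o ->
  is_phase phi th_phi -> is_phase s th_s -> mf_value th_phi th_s = (size zs)%:R.
Proof.
move=> C0 b1 hz fact phphi phs.
have [c [c1 phiE _]] := factorization_zeros C0 b1 hz fact.
have [d d1 sE] := singular_part_constant C0 b1 hz fact phs.
have [al cal] := normc_polar c; have [be dbe] := normc_polar d.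
rewrite c1 mul1r in cal; rewrite d1 mul1r in dbe.
(* Radial limits only involve points of the disc, so equality there transfers them. *)
have radial g g' t w : (forall z, in_disc z -> g z = g' z) ->
    radial_limit g' t w -> radial_limit g t w.
  move=> gE; apply: cvg_trans; apply: near_eq_cvg; near=> r.
  rewrite gE//; apply: in_disc_polar; apply/andP; split.
  - by near: r; apply: nbhs_left_ge; exact: ltr01.
  - by near: r; exact: nbhs_left_lt.
have hn : all_disc ([::] : seq R[i]) by [].
have phiE' z : in_disc z -> phi z = expi al * mobs zs z by move=> /phiE ->; rewrite cal.
have iphi := phase_integral_unique (cont_sphase' hz)
  (fun t => is_derive_sphase al t hz)
  (fun t => radial _ _ _ _ phiE' (radial_limit_mobs al t hz)) phphi.
have sE' z : in_disc z -> s z = expi be * mobs [::] z.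
  by move=> /sE ->; rewrite /mobs big_nil mulr1.
have is0 := phase_integral_unique (cont_sphase' hn)
  (fun t => is_derive_sphase be t hn)
  (fun t => radial _ _ _ _ sE' (radial_limit_mobs be t hn)) phs.
rewrite /mf_value -!/(Rintegral _ _ _) iphi is0 !integral_sphase'// mulr0 addr0.
by rewrite mulKf// gt_eqF// twopi_gt0.
Unshelve. all: by end_near. Qed.

Lemma geometric_coefs_mobs (C : R[i]) zs : all_disc zs ->
  geometric_coefs (fun z => C * mobs zs z).
Proof.
elim: zs => [|b zs IH].
  by move=> _; under eq_fun do rewrite /mobs big_nil mulr1; exact: geometric_coefs_cst.
move=> /all_disc_cons[hb hz].
rewrite (_ : (fun z => _) = (fun z => ((z - b) * (C * mobs zs z)) / (1 - b^* * z))); last first.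
  apply/funext => z; rewrite /mobs big_cons -/(mobs zs z) /mobius.
  by rewrite mulrCA mulrAC.
apply: geometric_coefs_div; first by rewrite in_discE normcJ.
by apply: geometric_coefs_sub; exact: IH.
Qed.

Lemma geometric_coefs_divX f b p : in_disc b -> geometric_coefs f ->
  geometric_coefs (fun z => f z / (1 - b * z) ^+ p).
Proof.
move=> b1 gf; elim: p => [|p IH]; first by under eq_fun do rewrite expr0 divr1.
under eq_fun do rewrite exprSr invfM mulrA.
exact: geometric_coefs_div.
Qed.

Lemma mean_frequency_rational (C : R) p b zs : 0 < C -> in_disc b -> all_disc zs ->
  mean_frequency_is (fun z => C%:C * mobs zs z / (1 - b * z) ^+ p) (size zs)%:R.
Proof.
move=> C0 b1 hz; split; [|split; [|split]].
- by apply: geometric_coefs_H2; apply: geometric_coefs_divX => //; exact: geometric_coefs_mobs.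
- have [r0 /andP[r00 r01] hr0] := zero_free_annulus hz.
  pose r := (r0 + 1) / 2; have r1 : 0 <= r < 1 by rewrite /r; apply/andP; split; lra.
  have rE : normc r%:C = r by rewrite normcR ger0_norm//; case/andP: r1.
  have z1 : in_disc r%:C by rewrite in_discE rE; case/andP: r1.
  exists r%:C; split => //; rewrite !mulf_neq0 ?invr_eq0//.
  + by rewrite fmorph_eq0 gt_eqF.
  + by rewrite mobs_eq0 ?(ltW z1)//; apply: hr0; rewrite rE /r; lra.
  + by rewrite expf_neq0// sub1_neq0// normcM_lt1.
- exists (mobs zs), (fun=> 1), (fun z => C%:C / (1 - b * z) ^+ p), (sphase 0 zs), (sphase 0 [::]).
  have e1 : (fun z : R[i] => expi 0 * mobs zs z) = mobs zs.
    by apply/funext => z; rewrite expi0 mul1r.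
  have e2 : (fun z : R[i] => expi 0 * mobs [::] z) = (fun=> 1).
    by apply/funext => z; rewrite expi0 mul1r /mobs big_nil.
  split; [split; [|split; [|split]]|split].
  + by rewrite -e1; apply: is_Blaschke_mobs => //; exact: normc_expi.
  + by apply: is_singular_inner_cst; exact: normc1.
  + exact: is_outer_rational.
  + by move=> z _; rewrite mulr1 mulrCA mulrA.
  + by rewrite -e1; exact: is_phase_mobs.
  + by rewrite -e2; exact: is_phase_mobs.
- by move=> phi s o th_phi th_s; exact: mean_frequency_unique.
Qed.

End MeanFrequency.

(** * Multiple Szegő kernels and Takenaka-Malmquist functions *)

Section Kernels.
Variable R : realType.

Lemma szego_kernelE n (a : R[i]) (C : R) :
  (fun z => C%:C * szego_kernel n a z) =
  (fun z => (C * n`!%:R)%:C * mobs (nseq n 0) z / (1 - a^* * z) ^+ n.+1).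
Proof.
apply/funext => z; rewrite mobs_nseq0 /szego_kernel rmorphM/= rmorph_nat.
by rewrite !mulrA.
Qed.

Lemma all_disc_nseq0 n : all_disc (nseq n (0 : R[i])).
Proof. by move=> b; rewrite mem_nseq => /andP[_ /eqP ->]; rewrite in_discE normc0. Qed.

(** The zeros are n copies of the origin. C = 1 gives the kernel itself and C the inverse of its
    norm the normalized one. *)
Lemma mean_frequency_szego n (a : R[i]) (C : R) : 0 < C -> in_disc a ->
  mean_frequency_is (fun z => C%:C * szego_kernel n a z) n%:R.
Proof.
move=> C0 a1; rewrite szego_kernelE -[n%:R](congr1 _ (size_nseq n (0 : R[i]))).
apply: mean_frequency_rational; last exact: all_disc_nseq0.
  by rewrite mulr_gt0// ltr0n fact_gt0.
by rewrite in_discE normcJ.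
Qed.

(** The n - 1 Moebius factors carry the zeros, and the remaining factor is outer with p = 1 and a
    positive constant. *)
Lemma mean_frequency_TM n (a : nat -> R[i]) : (1 <= n)%N ->
  (forall l : nat, (1 <= l <= n)%N -> in_disc (a l)) ->
  mean_frequency_is (TM n a) (n.-1)%:R.
Proof.
move=> n1 ha; have an1 : in_disc (a n) by apply: ha; rewrite n1 leqnn.
pose zs := [seq a l | l <- index_iota 1 n].
have zsn : size zs = n.-1 by rewrite size_map size_iota subn1.
rewrite (_ : TM n a = (fun z => (Num.sqrt (1 - normc (a n) ^+ 2))%:C * mobs zs z /
    (1 - (a n)^* * z) ^+ 1)) -?zsn; last first.
  by apply/funext => z; rewrite /TM /mobs big_map expr1 mulrAC.
apply: mean_frequency_rational.
- by rewrite sqrtr_gt0 subr_gt0 expr_lt1 ?normc_ge0.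
- by rewrite in_discE normcJ.
- move=> b /mapP[l]; rewrite mem_index_iota => /andP[l1 ln] ->.
  by apply: ha; rewrite l1 ltnW.
Qed.

End Kernels.

Theorem theorem1 (R : realType) :
  (forall (n : nat) (a : R[i]), in_disc a ->
     mean_frequency_is (szego_kernel n a) n%:R /\
     mean_frequency_is (normalized_szego_kernel n a) n%:R) /\
  (forall (n : nat) (a : nat -> R[i]), (1 <= n)%N ->
     (forall l : nat, (1 <= l <= n)%N -> in_disc (a l)) ->
     mean_frequency_is (TM n a) (n.-1)%:R).
Proof.
split; last exact: mean_frequency_TM.
move=> n a a1; split.
- rewrite (_ : szego_kernel n a = (fun z => (1 : R)%:C * szego_kernel n a z)).
    exact: mean_frequency_szego.
  by apply/funext => z; rewrite mul1r.
- rewrite (_ : normalized_szego_kernel n a =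
      (fun z => ((H2_norm (szego_kernel n a))^-1)%:C * szego_kernel n a z)).
    by apply: mean_frequency_szego => //; rewrite invr_gt0 szego_H2_norm_gt0.
  by apply/funext => z; rewrite /normalized_szego_kernel fmorphV mulrC.
Qed.
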